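(* Let $f,f_1,f_{12},f_2\in\mathbb{R}^3$ be a circular quadrilateral (its four vertices lie on a circle) with unit normals $n,n_1,n_{12},n_2\in\mathbb{S}^2$ at its vertices, such that $(f,n)$ is an edge-constraint quadrilateral with parallel Gauss map (on each of the four edges, the difference of the normals at its two endpoints is parallel to the edge) and with Gauss curvature $K=-1$. Then $(f,n)$ arises from the Lax representation: there are Lax data for one quadrilateral (as defined in the context) whose Lax matrices satisfy $M_1L=L_2M$ for all $\lambda>0$, and a solution $\Phi,\Phi_1,\Phi_2,\Phi_{12}$ of $$\Phi_1=L\Phi,\quad \Phi_2=M\Phi,\quad \Phi_{12}=M_1\Phi_1=L_2\Phi_2$$ with values in the nonzero quaternions, depending smoothly on $\lambda=e^t$, such that at each of the four vertices the given point and normal are $$2\left[\Phi^{-1}\frac{\partial}{\partial t}\Phi\right]^{\mathrm{tr}=0}\Big|_{\lambda=1}\quad\text{and}\quad -i\,\Phi^{-1}\sigma_3\Phi\Big|_{\lambda=1}$$ (evaluated at that vertex), respectively.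
   Context: Quaternions: $\mathbb{H}$ is the real span of the $2\times2$ matrices $\mathbb{1},-i\sigma_1,-i\sigma_2,-i\sigma_3$, where $\sigma_1=\begin{pmatrix}0&1\\1&0\end{pmatrix}$, $\sigma_2=\begin{pmatrix}0&-i\\i&0\end{pmatrix}$, $\sigma_3=\begin{pmatrix}1&0\\0&-1\end{pmatrix}$. $\mathbb{R}^3$ is identified with the imaginary (trace-free) quaternions by $(x_1,x_2,x_3)\leftrightarrow\sum_j x_j(-i\sigma_j)$, and $[X]^{\mathrm{tr}=0}$ is the trace-free part of $X\in\mathbb{H}$. Edge-constraint and curvature: a quadrilateral with vertices $f,f_1,f_{12},f_2$ (in cyclic order) and unit normals $n,n_1,n_{12},n_2$ is edge-constraint if each edge vector is perpendicular to the sum of the normals at its endpoints. A face normal is a unit vector $N\perp\mathrm{span}\{n_{12}-n,n_2-n_1\}$, and $K=\dfrac{\det(n_{12}-n,\,n_2-n_1,\,N)}{\det(f_{12}-f,\,f_2-f_1,\,N)}$. Lax data for one quadrilateral: unit complex numbers $s,s_1,s_2,s_{12}$ at the vertices; nonzero complex numbers $l$ (edge from $f$ to $f_1$), $l_2$ (edge from $f_2$ to $f_{12}$), $m$ (edge from $f$ to $f_2$), $m_1$ (edge from $f_1$ to $f_{12}$); parameters $\delta_1$ (the same for the edges of $l$ and $l_2$) and $\delta_2$ (the same for the edges of $m$ and $m_1$), each either real (with $\tan\frac{\delta_i}2\neq0$ finite) or complex with $\sin\delta_i$ real and $>1$ (in which case $|\tan\frac{\delta_i}2|=1$). All are independent of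 the spectral parameter $\lambda=e^t>0$. The Lax matrices are $$L=\begin{pmatrix}\cot\frac{\delta_1}2\frac{l}{s}+\tan\frac{\delta_1}2\,l s_1& i(\lambda-\frac{ss_1}{\lambda})\\ i(\lambda-\frac{1}{\lambda ss_1})&\cot\frac{\delta_1}2\frac{s}{l}+\tan\frac{\delta_1}2\frac{1}{l s_1}\end{pmatrix},\quad M=\begin{pmatrix}\cot\frac{\delta_2}2\frac{m}{s}+\tan\frac{\delta_2}2\,m s_2& i(\lambda-\frac{ss_2}{\lambda})\\ i(\lambda-\frac{1}{\lambda ss_2})&\cot\frac{\delta_2}2\frac{s}{m}+\tan\frac{\delta_2}2\frac{1}{m s_2}\end{pmatrix};$$ $L_2$ is obtained from $L$ by replacing $(l,s,s_1)$ with $(l_2,s_2,s_{12})$, and $M_1$ from $M$ by replacing $(m,s,s_2)$ with $(m_1,s_1,s_{12})$. The moduli of the edge variables are required to be such that these matrices are quaternions: for an edge in direction $i$ with vertex variables $e^{i\rho}$ (start) and $e^{i\rho_i}$ (end) the modulus of its edge variable is $$\sqrt{\frac{\cos(\rho_i-\arg\tan\frac{\delta_i}2)+\cos(\rho-\arg\tan\frac{\delta_i}2)}{\cos(\rho_i+\arg\tan\frac{\delta_i}2)+\cos(\rho+\arg\tan\frac{\delta_i}2)}},$$ which is $1$ when $\tan\frac{\delta_i}2$ is real.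
   Formalization: The four vertices are assumed distinct, and the unit normals at the two endpoints of any edge are assumed not antipodal; if they are antipodal on an edge, no Lax data exist and the claim as stated fails. *)

(* Defs.v *)
From mathcomp Require Import all_boot all_order all_algebra.
From mathcomp Require Import all_classical all_reals all_analysis.
From mathcomp Require Import complex.

Set Implicit Arguments.
Unset Strict Implicit.
Unset Printing Implicit Defensive.

Import Order.TTheory GRing.Theory Num.Theory.
Import numFieldNormedType.Exports.

Local Open Scope classical_set_scope.
Local Open Scope complex_scope.
Local Open Scope ring_scope.

Section ComplexFunctions.
Variable R : realType.
Implicit Types z : R[i].

Definition cexp z : R[i] :=
  (expR (complex.Re z))%:C * (cos (complex.Im z) +i* sin (complex.Im z)).

Definition csin z : R[i] :=
  (cexp ('i%C * z) - cexp (- ('i%C * z))) / (2 * 'i%C).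

Definition ccos z : R[i] :=
  (cexp ('i%C * z) + cexp (- ('i%C * z))) / 2.

Definition ctan z : R[i] := csin z / ccos z.

(* the argument of z != 0 in ]-pi, pi] *)
Definition carg z : R :=
  let a := acos (complex.Re z / Normc.normc z) in
  if 0 <= complex.Im z then a else - a.

End ComplexFunctions.

Section Euclidean.
Variable R : realType.
Implicit Types u v w f n N : 'rV[R]_3.

(* The norm that the library puts on 'rV[R]_3 is the sup norm, so lengths are
   expressed through the scalar product. *)
Definition dot u v : R := \sum_i u 0 i * v 0 i.

Definition unit_vector u : Prop := dot u u = 1.

Definition det3 u v w : R :=
  \det (\matrix_(i < 3, j < 3) (nth 0 [:: u; v; w] i) 0 j).

(* Four distinct points of the circle with centre c and radius r in the plane
   through c orthogonal to u. *)
Definition circular_quad f f1 f12 f2 : Prop :=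
  uniq [:: f; f1; f12; f2] /\
  exists (c u : 'rV[R]_3) (r : R),
    [/\ unit_vector u, 0 < r &
      forall p, p \in [:: f; f1; f12; f2] ->
        dot (p - c) (p - c) = r ^+ 2 /\ dot (p - c) u = 0].

Definition edge_constraint_edge f n f' n' : Prop := dot (f' - f) (n + n') = 0.

Definition edge_constraint_quad f f1 f12 f2 n n1 n12 n2 : Prop :=
  [/\ edge_constraint_edge f n f1 n1, edge_constraint_edge f1 n1 f12 n12,
      edge_constraint_edge f12 n12 f2 n2 & edge_constraint_edge f2 n2 f n].

Definition parallel_edge f n f' n' : Prop :=
  exists k : R, n' - n = k *: (f' - f).

Definition parallel_gauss_map f f1 f12 f2 n n1 n12 n2 : Prop :=
  [/\ parallel_edge f n f1 n1, parallel_edge f1 n1 f12 n12,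
      parallel_edge f12 n12 f2 n2 & parallel_edge f2 n2 f n].

Definition face_normal n n1 n12 n2 N : Prop :=
  [/\ unit_vector N, dot N (n12 - n) = 0 & dot N (n2 - n1) = 0].

(* If the denominator vanishes this is 0, hence not a nonzero curvature; if the
   value is nonzero then N is determined up to sign, and the sign cancels. *)
Definition gauss_curvature f f1 f12 f2 n n1 n12 n2 N : R :=
  det3 (n12 - n) (n2 - n1) N / det3 (f12 - f) (f2 - f1) N.

End Euclidean.

Section Quaternions.
Variable R : realType.

Definition mx2 (a b c d : R[i]) : 'M[R[i]]_2 :=
  \matrix_(i < 2, j < 2)
    (if i == 0 then (if j == 0 then a else b) else (if j == 0 then c else d)).

Definition sigma1 : 'M[R[i]]_2 := mx2 0 1 1 0.
Definition sigma2 : 'M[R[i]]_2 := mx2 0 (- 'i%C) 'i%C 0.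
Definition sigma3 : 'M[R[i]]_2 := mx2 1 0 0 (- 1).

Definition sigma (j : 'I_3) : 'M[R[i]]_2 :=
  nth 0 [:: sigma1; sigma2; sigma3] j.

Definition imquat (x : 'rV[R]_3) : 'M[R[i]]_2 :=
  \sum_(j < 3) (x 0 j)%:C *: (- 'i%C *: sigma j).

Definition quaternion (X : 'M[R[i]]_2) : Prop :=
  exists (a : R) (x : 'rV[R]_3), X = a%:C%:M + imquat x.

Definition tracefree (X : 'M[R[i]]_2) : 'M[R[i]]_2 := X - (\tr X / 2)%:M.

End Quaternions.

Section Lax.
Variable R : realType.

Definition lax_parameter (delta : R[i]) : Prop :=
  [/\ complex.Im delta = 0, csin (delta / 2) != 0 & ccos (delta / 2) != 0] \/
  (complex.Im (csin delta) = 0 /\ 1 < complex.Re (csin delta)).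

(* The Lax matrix of an edge with edge variable e, whose vertex variables are
   s (start) and s' (end). *)
Definition lax_matrix (delta e s s' : R[i]) (lam : R) : 'M[R[i]]_2 :=
  let T := ctan (delta / 2) in
  let la := lam%:C in
  mx2 (T^-1 * (e / s) + T * (e * s'))
      ('i%C * (la - s * s' / la))
      ('i%C * (la - 1 / (la * s * s')))
      (T^-1 * (s / e) + T * (1 / (e * s'))).

Definition edge_modulus (delta s s' : R[i]) : R :=
  let T := ctan (delta / 2) in
  if complex.Im T == 0 then 1
  else Num.sqrt ((cos (carg s' - carg T) + cos (carg s - carg T)) /
                 (cos (carg s' + carg T) + cos (carg s + carg T))).

Definition lax_edge (delta e s s' : R[i]) : Prop :=
  [/\ e != 0, `|e| = (edge_modulus delta s s')%:C &
    forall lam : R, 0 < lam -> quaternion (lax_matrix delta e s s' lam)].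

Record lax_data := LaxData {
  lax_s : R[i]; lax_s1 : R[i]; lax_s2 : R[i]; lax_s12 : R[i];
  lax_l : R[i]; lax_l2 : R[i]; lax_m : R[i]; lax_m1 : R[i];
  lax_delta1 : R[i]; lax_delta2 : R[i]
}.

Definition lax_data_ok (D : lax_data) : Prop :=
  let: LaxData s s1 s2 s12 l l2 m m1 delta1 delta2 := D in
  [/\ [/\ `|s| = 1, `|s1| = 1, `|s2| = 1 & `|s12| = 1],
      lax_parameter delta1, lax_parameter delta2 &
      [/\ lax_edge delta1 l s s1, lax_edge delta1 l2 s2 s12,
          lax_edge delta2 m s s2 & lax_edge delta2 m1 s1 s12]].

Variable D : lax_data.

Definition lax_L : R -> 'M[R[i]]_2 :=
  lax_matrix (lax_delta1 D) (lax_l D) (lax_s D) (lax_s1 D).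
Definition lax_L2 : R -> 'M[R[i]]_2 :=
  lax_matrix (lax_delta1 D) (lax_l2 D) (lax_s2 D) (lax_s12 D).
Definition lax_M : R -> 'M[R[i]]_2 :=
  lax_matrix (lax_delta2 D) (lax_m D) (lax_s D) (lax_s2 D).
Definition lax_M1 : R -> 'M[R[i]]_2 :=
  lax_matrix (lax_delta2 D) (lax_m1 D) (lax_s1 D) (lax_s12 D).

Definition lax_compatible : Prop :=
  forall lam : R, 0 < lam -> lax_M1 lam *m lax_L lam = lax_L2 lam *m lax_M lam.

(* Frames are functions of lambda, of which only the values at lambda > 0
   matter. *)
Implicit Types Phi : R -> 'M[R[i]]_2.

Definition lax_solution Phi Phi1 Phi2 Phi12 : Prop :=
  forall lam : R, 0 < lam ->
    [/\ Phi1 lam = lax_L lam *m Phi lam,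
        Phi2 lam = lax_M lam *m Phi lam,
        Phi12 lam = lax_M1 lam *m Phi1 lam &
        Phi12 lam = lax_L2 lam *m Phi2 lam].

End Lax.

Section SymBobenko.
Variable R : realType.
Implicit Types Phi : R -> 'M[R[i]]_2.

Definition nonzero_quaternion_valued Phi : Prop :=
  forall lam : R, 0 < lam -> quaternion (Phi lam) /\ Phi lam != 0.

(* real and imaginary parts of the entries of Phi, as functions of t, where
   lambda = e^t *)
Definition entry_re Phi (i j : 'I_2) (t : R) : R :=
  complex.Re (Phi (expR t) i j).
Definition entry_im Phi (i j : 'I_2) (t : R) : R :=
  complex.Im (Phi (expR t) i j).

Definition smooth (g : R -> R) : Prop :=
  forall (k : nat) (t : R), derivable (derive1n k g) t 1.

Definition smooth_frame Phi : Prop :=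
  forall i j, smooth (entry_re Phi i j) /\ smooth (entry_im Phi i j).

Definition dt Phi (t : R) : 'M[R[i]]_2 :=
  \matrix_(i, j) (derive1 (entry_re Phi i j) t +i* derive1 (entry_im Phi i j) t).

(* lambda = 1 is t = 0 *)
Definition frame_point Phi : 'M[R[i]]_2 :=
  2 *: tracefree (invmx (Phi 1) *m dt Phi 0).

Definition frame_normal Phi : 'M[R[i]]_2 :=
  - 'i%C *: (invmx (Phi 1) *m sigma3 R *m Phi 1).

Definition frame_represents Phi (f n : 'rV[R]_3) : Prop :=
  imquat f = frame_point Phi /\ imquat n = frame_normal Phi.

End SymBobenko.

(* Main.v *)
Require Import Defs.
From mathcomp Require Import all_boot all_order all_algebra.
From mathcomp Require Import all_classical all_reals all_analysis.
From mathcomp Require Import complex.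
From mathcomp Require Import ring lra.

Import Order.TTheory GRing.Theory Num.Theory.
Local Open Scope ring_scope.
Local Open Scope complex_scope.
Local Notation "z ^J" := (conjc z) (at level 1, left associativity, format "z ^J") : ring_scope.

Set Implicit Arguments.
Unset Strict Implicit.
Unset Printing Implicit Defensive.

(** Let [k] be the factor by which an edge [e] is stretched into the difference of
its normals. In a frame whose normal is the third axis, the Lax matrix of an
edge acts at [lambda = 1] as the rotation that carries the normal along the
edge, and its logarithmic derivative is the edge vector. This holds as soon as
  [s s' = (1 - i k) / (1 + i k)],   [sin^2 delta = (1 + k^2) |e|^2 / 4],
and the diagonal entry of the matrix has the value read off from the direction
of [e] in the frame ([frame_at_edge]); conversely every such matrix is the Lax
matrix of an edge variable of the prescribed modulus ([exists_lax_edge]). So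
each edge by itself has a Lax matrix, and three consistency conditions have to
be met around the quadrilateral.

The first two, [s s1 * s2 s12 = s s2 * s1 s12] and the equality of
[(1 + k^2) |e|^2] on opposite edges, are planar geometry
([concyclic_parallel_gauss_map]). In the plane of the circle the edges are
complex numbers [E_j] with [sum E_j = sum k_j E_j = 0], so the numbers
[(1 - i k_j) E_j] and [(1 + i k_j) E_j] are the sides of two more closed
quadrilaterals, with the same side lengths. Curvature [-1] amounts to
[(1 - k1 k3) (k2 + k4) = (1 - k2 k4) (k1 + k3)], that is to
[(1 - i k1) (1 - i k3)] being a real multiple of [(1 - i k2) (1 - i k4)]. This is
the first condition, and it makes the two new quadrilaterals concyclic with the
same cross-ratio. Side lengths and a real cross-ratio determine the angle
opposite to a diagonal unless the lengths satisfy two special relations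
([cyclic_quad_diagonal]). Equal angles in the two quadrilaterals force equal
[k] on adjacent edges; when both diagonals are taken into account, what survives
is equality of opposite side lengths, the second condition
([cyclic_quad_opposite_edges]).

The third condition is compatibility for all [lambda]. The two products of Lax
matrices lead at [lambda = 1] to frames of the same point and normal, hence
differ by a diagonal factor [diag(z, 1 / z)]. The derivatives at [lambda = 1]
differ by the same factor, but their diagonal entries depend on the vertex
variables only and coincide; so [z = 1], and value and derivative at
[lambda = 1] determine all the coefficients in [lambda]
([lax_compatible_at1]).

One vertex variable is still free; it is chosen so that [s + s'] vanishes on no
edge, where the formula for the modulus of the edge variable would read [0 / 0]
([exists_vertex_variables]). A frame at the first vertex whose derivative has
the prescribed value is [Phi0 (1 + (lambda - 1) f / 2)], and the Lax matrices
transport it to the other vertices ([lax_solution_through_frame]). *)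

(** * Linear certificates *)

Section LinearCombination.
Variable F : comNzRingType.
Implicit Types (a b c l r : F).

(** Certificates for goals that follow linearly from known equations: the
coefficients are supplied, and the remaining identity is left to [ring] or
[field]. *)
Lemma lincomb1 c l r a b : l = r -> a - b = c * (l - r) -> a = b.
Proof. by move=> -> /eqP; rewrite subrr mulr0 subr_eq0 => /eqP. Qed.

Lemma lincomb2 c l r c' l' r' a b : l = r -> l' = r' ->
  a - b = c * (l - r) + c' * (l' - r') -> a = b.
Proof. by move=> -> -> /eqP; rewrite !subrr !mulr0 addr0 subr_eq0 => /eqP. Qed.

Lemma lincomb3 c l r c' l' r' c2 l2 r2 a b : l = r -> l' = r' -> l2 = r2 ->
  a - b = c * (l - r) + c' * (l' - r') + c2 * (l2 - r2) -> a = b.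
Proof. by move=> -> -> -> /eqP; rewrite !subrr !mulr0 !addr0 subr_eq0 => /eqP. Qed.
End LinearCombination.
Arguments lincomb1 {F} c {l r a b}.
Arguments lincomb2 {F} c {l r} c' {l' r' a b}.
Arguments lincomb3 {F} c {l r} c' {l' r'} c2 {l2 r2 a b}.

(** * Concyclic quadrilaterals in the complex plane *)

Section Planar.
Variable R : realType.
Local Notation C := R[i].
Implicit Types (x z a : C).

Lemma conjcD x z : (x + z)^J = x^J + z^J. Proof. exact: rmorphD. Qed.
Lemma conjcN x : (- x)^J = - x^J. Proof. exact: rmorphN. Qed.
Lemma conjcM x z : (x * z)^J = x^J * z^J. Proof. exact: rmorphM. Qed.
Lemma conjcV x : (x^-1)^J = (x^J)^-1. Proof. exact: fmorphV. Qed.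
Lemma conjci : ('i%C : C)^J = - 'i%C.
Proof. by apply/eqP; rewrite eq_complex /= oppr0 !eqxx. Qed.

Lemma imaginary_neq0 : 'i%C != 0 :> C.
Proof. by rewrite eq_complex /= oner_eq0 andbF. Qed.

Lemma mul_ii : 'i%C * 'i%C = -1 :> C.
Proof. by rewrite -expr2 sqr_i. Qed.

Definition conjcE := (conjcD, conjcN, conjcM, conjcV, @conjcK, conjc0, conjc1,
  conjci, conjc_real, conjc_nat).

(** The square of one diagonal is computed by the law of cosines in each of the
two triangles that it cuts off. The real cross-ratio [x] turns [G1 G2^J] into a
real multiple of the conjugate of [G3 G4^J], which leaves a single linear
equation for the inner product of [G3] and [G4]. *)
Lemma cyclic_quad_diagonal (G1 G2 G3 G4 x : C) :
    G1 + G2 + G3 + G4 = 0 -> G1 * G3 = x * (G2 * G4) -> x^J = x ->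
  G3 * G3^J * (G1 * G2^J + G1^J * G2) = x * (G2 * G2^J) * (G3 * G4^J + G3^J * G4)
  /\ (x * (G2 * G2^J) - G3 * G3^J) * (G3 * G4^J + G3^J * G4) =
     G3 * G3^J * (G3 * G3^J + G4 * G4^J - G1 * G1^J - G2 * G2^J).
Proof.
move=> sumG cr xR.
have crc : G1^J * G3^J = x * (G2^J * G4^J).
  by rewrite -[in RHS]xR -!conjcM -cr conjcM.
have sumGc : G1^J + G2^J + G3^J + G4^J = 0 by rewrite -!conjcD sumG conjc0.
have E : G3 * G3^J * (G1 * G2^J + G1^J * G2) =
         x * (G2 * G2^J) * (G3 * G4^J + G3^J * G4).
  by apply: (lincomb2 (G3^J * G2^J) (G3 * G2) cr crc); ring.
split=> //.
apply: (lincomb3 (-1) (G3 * G3^J * (G1^J + G2^J))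
  (- (G3 * G3^J * (G3 + G4))) E sumG sumGc).
ring.
Qed.

(** The hypotheses [a + a^J = 2] encode [a = 1 - i k] with [k] real, so that
[a b^J = a^J b] says that [k] is the same for [a] and [b]. *)
Lemma eq_of_conj_mul (a b E F : C) :
    a + a^J = 2 -> b + b^J = 2 -> E * F^J != E^J * F ->
    a * b^J * (E * F^J) + a^J * b * (E^J * F) =
    a^J * b * (E * F^J) + a * b^J * (E^J * F) -> a = b.
Proof.
move=> ha hb; rewrite -subr_eq0 => hEF h.
have hab : (a * b^J - a^J * b) * (E * F^J - E^J * F) = 0.
  by apply: (lincomb1 1 h); ring.
move: hab => /eqP; rewrite mulf_eq0 (negbTE hEF) orbF => /eqP hab.
apply: (mulfI (_ : 2 != 0 :> C)); first by rewrite pnatr_eq0.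
by apply: (lincomb3 1 (- a) b hab hb ha); ring.
Qed.

(** The quadrilaterals with sides [a_j E_j] and [a_j^J E_j] have the same side
lengths and the same cross-ratio. If the equation of [cyclic_quad_diagonal] is
regular, then both have the same inner product of the third and fourth sides;
the difference of these inner products is [(a3 a4^J - a3^J a4)] times the area
form of [E3] and [E4], hence [a3 = a4]. *)
Lemma deformed_quad_diagonal (a1 a2 a3 a4 E1 E2 E3 E4 x : C) :
    [/\ a1 + a1^J = 2, a2 + a2^J = 2, a3 + a3^J = 2 & a4 + a4^J = 2] ->
    E1 + E2 + E3 + E4 = 0 ->
    a1 * E1 + a2 * E2 + a3 * E3 + a4 * E4 = 0 ->
    a1 * a3 * (E1 * E3) = x * (a2 * a4 * (E2 * E4)) ->
    a1^J * a3^J * (E1 * E3) = x * (a2^J * a4^J * (E2 * E4)) ->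
    x^J = x -> E1 * E2^J != E1^J * E2 -> E3 * E4^J != E3^J * E4 -> a3 != 0 ->
  (a1 = a2 /\ a3 = a4) \/
  (x * (a2 * a2^J * (E2 * E2^J)) = a3 * a3^J * (E3 * E3^J) /\
   a1 * a1^J * (E1 * E1^J) + a2 * a2^J * (E2 * E2^J) =
   a3 * a3^J * (E3 * E3^J) + a4 * a4^J * (E4 * E4^J)).
Proof.
move=> [ha1 ha2 ha3 ha4] sumE sumG crG crH xR ne12 ne34 a3_neq0.
have sumH : a1^J * E1 + a2^J * E2 + a3^J * E3 + a4^J * E4 = 0.
  have -> : a1^J = 2 - a1 by apply: (lincomb1 1 ha1); ring.
  have -> : a2^J = 2 - a2 by apply: (lincomb1 1 ha2); ring.
  have -> : a3^J = 2 - a3 by apply: (lincomb1 1 ha3); ring.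
  have -> : a4^J = 2 - a4 by apply: (lincomb1 1 ha4); ring.
  by apply: (lincomb2 2 (-1) sumE sumG); ring.
have E3_neq0 : E3 != 0.
  by apply: contraNneq ne34 => ->; rewrite conjc0 !mul0r.
have g3_neq0 : a3 * a3^J * (E3 * E3^J) != 0.
  by rewrite !mulf_neq0 // conjc_eq0.
have [] := @cyclic_quad_diagonal (a1 * E1) (a2 * E2) (a3 * E3)
   (a4 * E4) x sumG _ xR; first by apply: (lincomb1 1 crG); ring.
have [] := @cyclic_quad_diagonal (a1^J * E1) (a2^J * E2) (a3^J * E3)
   (a4^J * E4) x sumH _ xR; first by apply: (lincomb1 1 crH); ring.
rewrite !conjcE => H1 H2 G1 G2.
have [xg|xg] := eqVneq (x * (a2 * a2^J * (E2 * E2^J))) (a3 * a3^J * (E3 * E3^J)).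
  right; split=> //.
  apply: (mulfI g3_neq0); apply: (lincomb2 1
     (- (a3 * E3 * (a4^J * E4^J) + a3^J * E3^J * (a4 * E4))) G2 xg); ring.
left; move: xg; rewrite -subr_eq0 => xg.
have eqY : a3 * a4^J * (E3 * E4^J) + a3^J * a4 * (E3^J * E4) =
    a3^J * a4 * (E3 * E4^J) + a3 * a4^J * (E3^J * E4).
  by apply: (mulfI xg); apply: (lincomb2 1 (-1) G2 H2); ring.
split; last exact: eq_of_conj_mul eqY.
apply: (eq_of_conj_mul ha1 ha2 ne12); apply: (mulfI g3_neq0).
apply: (lincomb3 1 (-1) (x * (a2 * a2^J * (E2 * E2^J))) G1 H1 eqY); ring.
Qed.

(** Each diagonal gives the dichotomy of [deformed_quad_diagonal]. If both are
regular, all [a_j] coincide; if both are singular, the two relations between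
the lengths give the result. In a mixed case the [a_j] agree in pairs, so [x] is
also the cross-ratio of the [E_j], which is not [1] because the vertices are
distinct; the relations between the lengths then give the result again. *)
Lemma cyclic_quad_opposite_edges (a1 a2 a3 a4 E1 E2 E3 E4 : C) :
    [/\ a1 + a1^J = 2, a2 + a2^J = 2, a3 + a3^J = 2 & a4 + a4^J = 2] ->
    E1 + E2 + E3 + E4 = 0 ->
    a1 * E1 + a2 * E2 + a3 * E3 + a4 * E4 = 0 ->
    E1 * E3 * (E2 * E4)^J = (E1 * E3)^J * (E2 * E4) ->
    [/\ E1 * E2^J != E1^J * E2, E2 * E3^J != E2^J * E3,
        E3 * E4^J != E3^J * E4 & E4 * E1^J != E4^J * E1] ->
    a1 * a3 * (a2 * a4)^J = (a1 * a3)^J * (a2 * a4) ->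
    ~ [/\ a1 = a2, a2 = a3 & a3 = a4] ->
  a1 * a1^J * (E1 * E1^J) = a3 * a3^J * (E3 * E3^J) /\
  a2 * a2^J * (E2 * E2^J) = a4 * a4^J * (E4 * E4^J).
Proof.
move=> [ha1 ha2 ha3 ha4] sumE sumG circ [ne12 ne23 ne34 ne41] par neq.
have nz (a : C) : a + a^J = 2 -> a != 0.
  by apply: contra_eq_neq => ->; rewrite conjc0 addr0 eq_sym pnatr_eq0.
have nzE (E F : C) : E * F^J != E^J * F -> E != 0.
  by apply: contraNneq => ->; rewrite conjc0 !mul0r.
have E1_neq0 := nzE _ _ ne12; have E2_neq0 := nzE _ _ ne23.
have E3_neq0 := nzE _ _ ne34; have E4_neq0 := nzE _ _ ne41.
have a1_neq0 := nz _ ha1; have a2_neq0 := nz _ ha2.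
have a3_neq0 := nz _ ha3; have a4_neq0 := nz _ ha4.
move: circ par; rewrite !conjcM => circ par.
have c0 (z : C) : z != 0 -> z^J != 0 by rewrite conjc_eq0.
pose x := (a1 * a3 * (E1 * E3)) / (a2 * a4 * (E2 * E4)).
have x_neq0 : x != 0 by rewrite !mulf_neq0 ?invr_eq0 ?mulf_neq0.
have crG : a1 * a3 * (E1 * E3) = x * (a2 * a4 * (E2 * E4)).
  by rewrite /x divfK // !mulf_neq0.
have crH : a1^J * a3^J * (E1 * E3) = x * (a2^J * a4^J * (E2 * E4)).
  have den : a2 * a4 * (E2 * E4) != 0 by rewrite !mulf_neq0.
  rewrite /x [RHS]mulrAC -[LHS](mulfK den); congr (_ * _).
  by apply: (lincomb1 (- (E1 * E3 * (E2 * E4))) par); ring.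
have xR : x^J = x.
  rewrite /x !conjcE; apply/eqP.
  rewrite eqr_div ?mulf_neq0 ?c0 //; apply/eqP.
  apply: (lincomb2 (- (E1^J * E3^J * (E2 * E4)))
    (- (a1 * a3 * (a2^J * a4^J))) par circ); ring.
move: x x_neq0 crG crH xR => x x_neq0 crG crH xR.
have crG' : a2 * a4 * (E2 * E4) = x^-1 * (a3 * a1 * (E3 * E1)).
  by apply: (mulfI x_neq0); rewrite mulVKf // -crG; ring.
have crH' : a2^J * a4^J * (E2 * E4) = x^-1 * (a3^J * a1^J * (E3 * E1)).
  apply: (mulfI x_neq0); rewrite mulVKf // -crH; ring.
have xR' : (x^-1)^J = x^-1 by rewrite conjcV xR.
have sumE' : E2 + E3 + E4 + E1 = 0 by rewrite -sumE; ring.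
have sumG' : a2 * E2 + a3 * E3 + a4 * E4 + a1 * E1 = 0 by rewrite -sumG; ring.
have D := deformed_quad_diagonal (And4 ha1 ha2 ha3 ha4) sumE sumG crG crH xR
  ne12 ne34 a3_neq0.
have D' := deformed_quad_diagonal (And4 ha2 ha3 ha4 ha1) sumE' sumG' crG' crH' xR'
  ne23 ne41 a4_neq0.
set g1 := a1 * a1^J * _ in D D' *; set g2 := a2 * a2^J * _ in D D' *.
set g3 := a3 * a3^J * _ in D D' *; set g4 := a4 * a4^J * _ in D D' *.
have two : 2 != 0 :> C by rewrite pnatr_eq0.
(* squared moduli in [crG] *)
have crg : g1 * g3 = x ^+ 2 * (g2 * g4).
  have : (a1 * a3 * (E1 * E3))^J = (x * (a2 * a4 * (E2 * E4)))^J by rewrite crG.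
  rewrite !conjcM xR => h.
  apply: (lincomb2 (a1^J * a3^J * (E1^J * E3^J)) (x * (a2 * a4 * (E2 * E4))) crG h).
  rewrite /g1 /g2 /g3 /g4; ring.
have g_neq0 : g3 != 0 /\ g4 != 0 by rewrite /g3 /g4 !mulf_neq0 ?c0.
have [g3_neq0 g4_neq0] := g_neq0.
have x1 : a1 * a3 = a2 * a4 -> x != 1.
  move=> h; apply/negP => /eqP x1.
  have h2 : E1 * E3 = E2 * E4.
    apply: (mulfI (_ : a1 * a3 != 0)); first by rewrite mulf_neq0.
    by rewrite crG x1 -h mul1r.
  have : (E1 + E2) * (E2 + E3) = 0 by apply: (lincomb2 1 E2 h2 sumE); ring.
  move=> /eqP; rewrite mulf_eq0 => /orP[/eqP h0|/eqP h0].
    have e : E1 = - E2 by apply: (lincomb1 1 h0); ring.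
    by move: ne12; rewrite e conjcN; case/eqP; ring.
  have e : E2 = - E3 by apply: (lincomb1 1 h0); ring.
  by move: ne23; rewrite e conjcN; case/eqP; ring.
have fin : a1 * a3 = a2 * a4 -> (1 - x) * (g2 - g4) = 0 -> g2 = g4.
  move=> /x1; rewrite eq_sym -subr_eq0 => h /eqP.
  by rewrite mulf_eq0 (negbTE h) /= subr_eq0 => /eqP.
case: D => [[e12 e34]|[xg sg]]; case: D' => [[e23 e41]|[xg' sg']].
- by exfalso; exact: neq.
- have g3E : g3 = x * g4 by rewrite -xg' mulVKf.
  have g1E : g1 = x * g2.
    apply: (mulIf g3_neq0); rewrite crg g3E; ring.
  have g24 : g2 = g4.
    apply: fin; first by rewrite e12 e34; ring.
    apply: (lincomb1 1 sg'); rewrite g3E g1E; ring.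
  by rewrite g3E g1E g24.
- have g1E : g1 = x * g4.
    apply: (mulIf g3_neq0); rewrite crg -xg; ring.
  have g24 : g2 = g4.
    apply: fin; first by rewrite -e23 e41; ring.
    apply: (lincomb1 1 sg); rewrite -xg g1E; ring.
  by rewrite -xg g1E g24.
split; apply: (mulfI two).
  by apply: (lincomb2 1 (-1) sg sg'); ring.
by apply: (lincomb2 1 1 sg sg'); ring.
Qed.

(** This is [2 i] times the area form of the plane. *)
Definition bracket (z z' : C) : C := z^J * z' - z * z'^J.

(** On the circle [|z|^2 = rho] conjugation is [z |-> rho / z], which makes the
two sides differ by a product of differences of the vertices. *)
Lemma concyclic_not_collinear (rho z1 z2 z3 : C) : rho != 0 ->
    z1 * z1^J = rho -> z2 * z2^J = rho -> z3 * z3^J = rho ->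
    z1 != z2 -> z2 != z3 -> z1 != z3 ->
  (z2 - z1) * (z3 - z2)^J != (z2 - z1)^J * (z3 - z2).
Proof.
move=> rho0 h1 h2 h3 n12 n23 n13.
have z1_neq0 : z1 != 0 by apply: contraNneq rho0 => z0; rewrite -h1 z0 mul0r.
have z2_neq0 : z2 != 0 by apply: contraNneq rho0 => z0; rewrite -h2 z0 mul0r.
have z3_neq0 : z3 != 0 by apply: contraNneq rho0 => z0; rewrite -h3 z0 mul0r.
have -> : (z2 - z1) * (z3 - z2)^J = (z2 - z1)^J * (z3 - z2)
           + rho * (z1 - z2) * (z2 - z3) * (z3 - z1) / (z1 * z2 * z3).
  have e1 : z1^J = rho / z1 by rewrite -h1 mulrC mulKf.
  have e2 : z2^J = rho / z2 by rewrite -h2 mulrC mulKf.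
  have e3 : z3^J = rho / z3 by rewrite -h3 mulrC mulKf.
  rewrite !conjcE e1 e2 e3; field.
  by rewrite z1_neq0 z2_neq0 z3_neq0.
rewrite -subr_eq0 addrC addKr.
by rewrite !mulf_neq0 ?invr_eq0 ?mulf_neq0 // subr_eq0 // eq_sym.
Qed.

Lemma concyclic_cross_ratio (rho z1 z2 z3 z4 : C) : rho != 0 ->
    z1 * z1^J = rho -> z2 * z2^J = rho -> z3 * z3^J = rho -> z4 * z4^J = rho ->
  (z2 - z1) * (z4 - z3) * ((z3 - z2) * (z1 - z4))^J =
  ((z2 - z1) * (z4 - z3))^J * ((z3 - z2) * (z1 - z4)).
Proof.
move=> rho0 h1 h2 h3 h4.
have z1_neq0 : z1 != 0 by apply: contraNneq rho0 => z0; rewrite -h1 z0 mul0r.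
have z2_neq0 : z2 != 0 by apply: contraNneq rho0 => z0; rewrite -h2 z0 mul0r.
have z3_neq0 : z3 != 0 by apply: contraNneq rho0 => z0; rewrite -h3 z0 mul0r.
have z4_neq0 : z4 != 0 by apply: contraNneq rho0 => z0; rewrite -h4 z0 mul0r.
have e1 : z1^J = rho / z1 by rewrite -h1 mulrC mulKf.
have e2 : z2^J = rho / z2 by rewrite -h2 mulrC mulKf.
have e3 : z3^J = rho / z3 by rewrite -h3 mulrC mulKf.
have e4 : z4^J = rho / z4 by rewrite -h4 mulrC mulKf.
rewrite !conjcE e1 e2 e3 e4; field.
by rewrite z1_neq0 z2_neq0 z3_neq0 z4_neq0.
Qed.

(** The closing relations say that the vector of the [k_j - k4] is proportional to
the vector of the areas spanned by pairs of edges. Substituting this into the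
curvature relation eliminates the areas and leaves a relation between the
[k_j] alone, the addition formula for the tangents of the angles
[arctan k_j]. *)
Lemma curvature_tangent_sum (k1 k2 k3 k4 E1 E2 E3 E4 : C) :
    [/\ k1^J = k1, k2^J = k2, k3^J = k3 & k4^J = k4] ->
    E1 + E2 + E3 + E4 = 0 ->
    k1 * E1 + k2 * E2 + k3 * E3 + k4 * E4 = 0 ->
    bracket (k1 * E1 + k2 * E2) (k2 * E2 + k3 * E3) =
      - bracket (E1 + E2) (E2 + E3) ->
    bracket (E1 + E2) (E2 + E3) != 0 -> bracket E1 E2 != 0 -> 1 + k3 ^+ 2 != 0 ->
  (1 - k1 * k3) * (k2 + k4) = (1 - k2 * k4) * (k1 + k3) /\
  ~ [/\ k1 = k2, k2 = k3 & k3 = k4].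
Proof.
move=> [r1 r2 r3 r4] sumE sumK; rewrite /bracket !conjcE r1 r2 r3 => K A0 c0 k0.
have sumEc : E1^J + E2^J + E3^J + E4^J = 0 by rewrite -!conjcD sumE conjc0.
have sumKc : k1 * E1^J + k2 * E2^J + k3 * E3^J + k4 * E4^J = 0.
  by move/(congr1 (@conjc R)): sumK; rewrite !conjcE r1 r2 r3 r4.
set al := E2^J * E3 - E2 * E3^J; set be := E3^J * E1 - E3 * E1^J.
set ga := E1^J * E2 - E1 * E2^J in c0 *.
have al_eq : (k1 - k4) * ga = (k3 - k4) * al.
  have h : (k1 - k4) * E1 + (k2 - k4) * E2 + (k3 - k4) * E3 = 0.
    by apply: (lincomb2 1 (- k4) sumK sumE); ring.
  have hc : (k1 - k4) * E1^J + (k2 - k4) * E2^J + (k3 - k4) * E3^J = 0.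
    by apply: (lincomb2 1 (- k4) sumKc sumEc); ring.
  by apply: (lincomb2 E2 (- E2^J) hc h); rewrite /ga /al; ring.
have be_eq : (k2 - k4) * ga = (k3 - k4) * be.
  have h : (k1 - k4) * E1 + (k2 - k4) * E2 + (k3 - k4) * E3 = 0.
    by apply: (lincomb2 1 (- k4) sumK sumE); ring.
  have hc : (k1 - k4) * E1^J + (k2 - k4) * E2^J + (k3 - k4) * E3^J = 0.
    by apply: (lincomb2 1 (- k4) sumKc sumEc); ring.
  by apply: (lincomb2 E1^J (- E1) h hc); rewrite /ga /be; ring.
have Kbr : k1 * k2 * ga - k1 * k3 * be + k2 * k3 * al = - (ga - be + al).
  by apply: (lincomb1 1 K); rewrite /ga /be /al; ring.
have nall : ~ [/\ k1 = k2, k2 = k3 & k3 = k4].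
  move=> [e1 e2 e3]; move: Kbr; rewrite e1 e2 => Kbr.
  have : (1 + k3 ^+ 2) * (ga - be + al) = 0 by apply: (lincomb1 1 Kbr); ring.
  move=> /eqP; rewrite mulf_eq0 (negbTE k0) => /eqP A.
  case/eqP: A0; rewrite -[RHS]A /ga /be /al; ring.
split=> //.
have k34 : k3 - k4 != 0.
  apply: contra_notN nall; rewrite subr_eq0 => /eqP k34.
  move: al_eq be_eq; rewrite k34 subrr !mul0r => /eqP.
  rewrite mulf_eq0 (negbTE c0) orbF subr_eq0 => /eqP-> /eqP.
  by rewrite mulf_eq0 (negbTE c0) orbF subr_eq0 => /eqP->.
apply: (mulfI c0).
have := Kbr.
move=> /(congr1 (fun z => (k3 - k4) * z)) Kk.
apply: (lincomb3 (-1) (- 1 - k2 * k3) (1 + k1 * k3) Kk al_eq be_eq).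
ring.
Qed.

Lemma real_sqr1D_neq0 (k : R) : 1 + k%:C ^+ 2 != 0 :> C.
Proof.
rewrite -rmorphXn -(rmorph1 (real_complex R)) -rmorphD /=.
rewrite (inj_eq (@complexI R) _ 0) gt_eqF //.
by rewrite ltr_wpDr ?sqr_ge0.
Qed.

(** The planar content of the theorem. It applies [cyclic_quad_opposite_edges] to
[a_j = 1 - i k_j], whose squared modulus is [1 + k_j^2]. *)
Lemma concyclic_parallel_gauss_map (k1 k2 k3 k4 : R) (rho z1 z2 z3 z4 : C) :
    rho != 0 ->
    [/\ z1 * z1^J = rho, z2 * z2^J = rho, z3 * z3^J = rho & z4 * z4^J = rho] ->
    uniq [:: z1; z2; z3; z4] ->
    let E1 := z2 - z1 in let E2 := z3 - z2 in
    let E3 := z4 - z3 in let E4 := z1 - z4 in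
    k1%:C * E1 + k2%:C * E2 + k3%:C * E3 + k4%:C * E4 = 0 ->
    bracket (k1%:C * E1 + k2%:C * E2) (k2%:C * E2 + k3%:C * E3) =
      - bracket (E1 + E2) (E2 + E3) ->
    bracket (E1 + E2) (E2 + E3) != 0 ->
  [/\ (1 + k1%:C ^+ 2) * (E1 * E1^J) = (1 + k3%:C ^+ 2) * (E3 * E3^J),
      (1 + k2%:C ^+ 2) * (E2 * E2^J) = (1 + k4%:C ^+ 2) * (E4 * E4^J),
      (1 - k1 * k3) * (k2 + k4) = (1 - k2 * k4) * (k1 + k3) &
      ~ [/\ k1 = k2, k2 = k3 & k3 = k4]].
Proof.
move=> rho0 [h1 h2 h3 h4].
rewrite [uniq _]/= !inE !negb_or !andbT.
move=> /and3P[/and3P[n12 n13 n14] /andP[n23 n24] n34] E1 E2 E3 E4 sumK K A0.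
have sumE : E1 + E2 + E3 + E4 = 0 by rewrite /E1 /E2 /E3 /E4; ring.
have ne12 : E1 * E2^J != E1^J * E2 by apply: (concyclic_not_collinear rho0 h1).
have ne23 : E2 * E3^J != E2^J * E3 by apply: (concyclic_not_collinear rho0 h2).
have ne34 : E3 * E4^J != E3^J * E4.
  by apply: (concyclic_not_collinear rho0 h3) => //; rewrite eq_sym.
have ne41 : E4 * E1^J != E4^J * E1.
  by apply: (concyclic_not_collinear rho0 h4) => //; rewrite eq_sym.
have rk (k : R) := conjc_real k.
have [|par nall] := curvature_tangent_sum (And4 (rk k1) (rk k2) (rk k3) (rk k4))
  sumE sumK K A0 _ (real_sqr1D_neq0 k3).
  by rewrite /bracket subr_eq0 eq_sym.
have kI (k k' : R) : k%:C = k'%:C -> k = k' by exact: complexI.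
have par' : (1 - k1 * k3) * (k2 + k4) = (1 - k2 * k4) * (k1 + k3).
  apply: (@complexI R); move: par.
  by rewrite !(rmorphM, rmorphB, rmorphD, rmorph1).
have nall' : ~ [/\ k1 = k2, k2 = k3 & k3 = k4].
  by move=> [e1 e2 e3]; apply: nall; rewrite e1 e2 e3.
pose a (k : R) : C := 1 - 'i%C * k%:C.
have aP k : a k + (a k)^J = 2 by rewrite /a !conjcE; ring.
have aN k : a k * (a k)^J = 1 + k%:C ^+ 2.
  by rewrite /a !conjcE; apply: (lincomb1 (- k%:C ^+ 2) mul_ii); ring.
have ai k k' : a k = a k' -> k = k'.
  move=> h; apply: kI; apply: (lincomb2 'i%C (k%:C - k'%:C) h mul_ii).
  rewrite /a; ring.
have [] := @cyclic_quad_opposite_edges (a k1) (a k2) (a k3) (a k4) E1 E2 E3 E4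
  (And4 (aP _) (aP _) (aP _) (aP _)) sumE.
- apply: (lincomb2 1 (- 'i%C) sumE sumK); rewrite /a; ring.
- exact: (concyclic_cross_ratio rho0 h1 h2 h3 h4).
- by [].
- rewrite /a !conjcE.
  apply: (lincomb2 (2 * 'i%C) (2 * 'i%C * (k1%:C * k3%:C * (k2%:C + k4%:C)
    - k2%:C * k4%:C * (k1%:C + k3%:C))) par mul_ii).
  ring.
- by move=> [e1 e2 e3]; apply: nall'; split; apply: ai.
by rewrite !aN.
Qed.
End Planar.

(** * Quaternions as complex matrices *)

Section Quaternions.
Variable R : realType.
Local Notation C := R[i].
Local Notation M2 := 'M[R[i]]_2.
Implicit Types (a b c d A B : C) (x y z n f e : 'rV[R]_3) (X Y : M2).

Lemma mx2M a b c d a' b' c' d' :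
  mx2 a b c d *m mx2 a' b' c' d' =
  mx2 (a * a' + b * c') (a * b' + b * d') (c * a' + d * c') (c * b' + d * d').
Proof.
apply/matrixP => i j; rewrite !mxE 2!big_ord_recl big_ord0 addr0 !mxE /=.
by case: (i == 0); case: (j == 0).
Qed.

Lemma mx2D a b c d a' b' c' d' :
  mx2 a b c d + mx2 a' b' c' d' = mx2 (a + a') (b + b') (c + c') (d + d').
Proof.
by apply/matrixP => i j; rewrite !mxE; case: (i == 0); case: (j == 0).
Qed.

Lemma mx2Z k a b c d : k *: mx2 a b c d = mx2 (k * a) (k * b) (k * c) (k * d).
Proof.
by apply/matrixP => i j; rewrite !mxE; case: (i == 0); case: (j == 0).
Qed.

(** Case analysis on row and column indices that presents them as [0] and [1]. *)
Lemma ord2P (P : 'I_2 -> Prop) : P 0 -> P 1 -> forall i, P i.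
Proof.
move=> P0 P1; case=> [[|[|]]] // i; last by congr P: P1; apply: val_inj.
by congr P: P0; apply: val_inj.
Qed.

Lemma mx2_eta X : X = mx2 (X 0 0) (X 0 1) (X 1 0) (X 1 1).
Proof. by apply/matrixP; elim/ord2P; elim/ord2P; rewrite mxE. Qed.

Lemma mx2_inj a b c d a' b' c' d' : mx2 a b c d = mx2 a' b' c' d' ->
  [/\ a = a', b = b', c = c' & d = d'].
Proof.
move=> /matrixP h.
by split; [move: (h 0 0) | move: (h 0 1) | move: (h 1 0) | move: (h 1 1)];
  rewrite !mxE.
Qed.

Lemma mx2_scalar a : a%:M = mx2 a 0 0 a.
Proof. by rewrite [LHS]mx2_eta !mxE. Qed.

Lemma trace_mx2 a b c d : \tr (mx2 a b c d) = a + d.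
Proof. by rewrite /mxtrace 2!big_ord_recl big_ord0 addr0 !mxE. Qed.

Definition quat A B : M2 := mx2 A B (- B^J) A^J.

Lemma quatM A B A' B' :
  quat A B *m quat A' B' = quat (A * A' - B * B'^J) (A * B' + B * A'^J).
Proof. by rewrite /quat mx2M !conjcE; congr mx2; ring. Qed.

Lemma quatD A B A' B' : quat A B + quat A' B' = quat (A + A') (B + B').
Proof. by rewrite /quat mx2D !conjcE; congr mx2; ring. Qed.

Lemma quatZ (r : R) A B : r%:C *: quat A B = quat (r%:C * A) (r%:C * B).
Proof. by rewrite /quat mx2Z !conjcE; congr mx2; ring. Qed.

Lemma quat_inj A B A' B' : quat A B = quat A' B' -> A = A' /\ B = B'.
Proof. by move=> /mx2_inj[]. Qed.

(** The entries of the imaginary quaternion of [x]: the third coordinate goes to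
the diagonal, the other two to the off-diagonal entry. *)
Definition offdiag x : C := - x 0 1 +i* - x 0 0.
Definition diagpart x : C := 0 +i* - x 0 2%:R.

Lemma imquatE x : imquat x = quat (diagpart x) (offdiag x).
Proof.
rewrite /imquat 3!big_ord_recl big_ord0 addr0 /sigma /= /sigma1 /sigma2 /sigma3.
rewrite !mx2Z !mx2D /quat /diagpart /offdiag /=.
have -> : lift ord0 (ord0 : 'I_2) = 1 :> 'I_3 by apply: val_inj.
have -> : lift ord0 (lift ord0 (ord0 : 'I_1)) = 2%:R :> 'I_3 by apply: val_inj.
by congr mx2; apply/eqP; rewrite eq_complex /=; apply/andP; split; apply/eqP;
  ring.
Qed.

Lemma imquatD x y : imquat (x + y) = imquat x + imquat y.
Proof.
rewrite !imquatE quatD /diagpart /offdiag !mxE.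
by congr quat; apply/eqP; rewrite eq_complex /= ?addr0 ?opprD !eqxx.
Qed.

Lemma imquatZ (r : R) x : imquat (r *: x) = r%:C *: imquat x.
Proof.
rewrite !imquatE quatZ /diagpart /offdiag !mxE.
by congr quat; simpc; rewrite ?mulrN.
Qed.

Lemma imquat_inj x y : imquat x = imquat y -> x = y.
Proof.
rewrite !imquatE => /quat_inj[[e2] [e1 e0]].
apply/rowP => i.
case: i => [[|[|[|]]]] // p.
- by move/oppr_inj: e0; congr (x _ _ = y _ _); apply: val_inj.
- by move/oppr_inj: e1; congr (x _ _ = y _ _); apply: val_inj.
- by move/oppr_inj: e2; congr (x _ _ = y _ _); apply: val_inj.
Qed.

Lemma quaternionP X : quaternion X <-> exists A B, X = quat A B.
Proof.
split=> [[r [x ->]]|[A [B ->]]].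
  exists (r%:C + diagpart x), (offdiag x).
  rewrite imquatE mx2_scalar /quat mx2D !conjcE; congr mx2; ring.
exists (complex.Re A), (\row_i (if i == 0 then - complex.Im B else
   if i == 1 then - complex.Re B else - complex.Im A)).
rewrite imquatE mx2_scalar /quat mx2D /diagpart /offdiag !mxE /= !opprK.
by case: A => a a'; case: B => b b' /=; congr mx2; simpc.
Qed.

Lemma quat1 : quat 1 0 = 1%:M :> M2.
Proof. by rewrite mx2_scalar /quat !conjcE oppr0. Qed.

Lemma quat00 : quat 0 0 = 0.
Proof. by rewrite [RHS]mx2_eta !mxE /quat !conjcE oppr0. Qed.

Lemma quatN A B : - quat A B = quat (- A) (- B).
Proof.
by rewrite -scaleN1r -[-1](rmorphN1 (real_complex R)) quatZ rmorphN1 !mulN1r.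
Qed.

Lemma quat2Z A B : 2 *: quat A B = quat (2 * A) (2 * B).
Proof. by rewrite -(rmorph_nat (real_complex R) 2) quatZ. Qed.

Lemma quat_adj A B : quat A B *m quat A^J (- B) = (A * A^J + B * B^J)%:M.
Proof.
by rewrite quatM mx2_scalar /quat !conjcE; congr mx2; ring.
Qed.

Lemma sum_mulJ_eq0 A B : (A * A^J + B * B^J == 0) = (A == 0) && (B == 0).
Proof. by rewrite paddr_eq0 ?mulcJ_ge0 // !mulf_eq0 !conjc_eq0 !orbb. Qed.

Lemma quat_unit A B : A * A^J + B * B^J != 0 -> quat A B \in unitmx.
Proof.
move=> N0; have /mulmx1_unit[] // : quat A B *m
    ((A * A^J + B * B^J)^-1 *: quat A^J (- B)) = 1%:M.
by rewrite -scalemxAr quat_adj scale_scalar_mx mulVf.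
Qed.

Lemma quat_neq0 A B : quat A B != 0 -> quat A B \in unitmx.
Proof.
move=> X0; apply: quat_unit; apply: contraNneq X0 => /eqP.
rewrite sum_mulJ_eq0 => /andP[/eqP-> /eqP->].
by rewrite quat00.
Qed.

Lemma quaternionM X Y : quaternion X -> quaternion Y -> quaternion (X *m Y).
Proof.
move=> /quaternionP[A [B ->]] /quaternionP[A' [B' ->]].
by apply/quaternionP; rewrite quatM; eexists; eexists.
Qed.

Lemma dotE x y : dot x y = x 0 0 * y 0 0 + x 0 1 * y 0 1 + x 0 2%:R * y 0 2%:R.
Proof.
rewrite /dot 3!big_ord_recl big_ord0 addr0 addrA.
by congr (_ + _ + _); congr (x _ _ * y _ _); apply: val_inj.
Qed.

Lemma det3E x y z : det3 x y z =
  x 0 0 * (y 0 1 * z 0 2%:R - y 0 2%:R * z 0 1)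
  - x 0 1 * (y 0 0 * z 0 2%:R - y 0 2%:R * z 0 0)
  + x 0 2%:R * (y 0 0 * z 0 1 - y 0 1 * z 0 0).
Proof.
pose c (v : 'rV[R]_3) (k : nat) : R := v 0 (inord k).
have cE (v : 'rV[R]_3) i : v 0 i = c v (val i) by rewrite /c inord_val.
rewrite /det3 (expand_det_row _ 0) !big_ord_recl big_ord0 /cofactor.
rewrite !(expand_det_row _ (0 : 'I_2)) !big_ord_recl !big_ord0 /cofactor.
rewrite !det_mx11 !mxE /= !cE.
rewrite /bump /=.
move: (c x) (c y) (c z) => {}x {}y {}z.
ring.
Qed.

Lemma trace_imquat2 x y : \tr (imquat x *m imquat y) = (- 2 * dot x y)%:C.
Proof.
rewrite !imquatE quatM trace_mx2 dotE /diagpart /offdiag.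
apply/eqP; rewrite eq_complex /=.
by apply/andP; split; apply/eqP; ring.
Qed.

Lemma trace_imquat3 x y z :
  \tr (imquat x *m imquat y *m imquat z) = (- 2 * det3 x y z)%:C.
Proof.
rewrite !imquatE !quatM trace_mx2 det3E /diagpart /offdiag.
apply/eqP; rewrite eq_complex /=.
by apply/andP; split; apply/eqP; ring.
Qed.
End Quaternions.

(** * Rotations carried by quaternions *)

Section Frames.
Variable R : realType.
Local Notation C := R[i].
Local Notation M2 := 'M[R[i]]_2.
Implicit Types (a b c d A B : C) (x y z n f e : 'rV[R]_3) (X Y Z : M2).

Definition axis : 'rV[R]_3 := \row_i (if i == 2%:R then 1 else 0).

Lemma axisE : [/\ axis 0 0 = 0, axis 0 1 = 0 & axis 0 2%:R = 1].
Proof. by rewrite !mxE. Qed.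

Lemma imquat_axis : imquat axis = quat (- 'i%C) 0.
Proof.
have [e0 e1 e2] := axisE; rewrite imquatE /diagpart /offdiag e0 e1 e2.
by congr quat; apply/eqP; rewrite eq_complex; simpc; rewrite /= ?eqxx.
Qed.

Lemma imquat_axis_sigma3 : imquat axis = - 'i%C *: sigma3 R.
Proof.
rewrite imquat_axis /sigma3 mx2Z /quat !conjcE; congr mx2; ring.
Qed.

Lemma dot_axis x : dot x axis = x 0 2%:R.
Proof. by have [e0 e1 e2] := axisE; rewrite dotE e0 e1 e2; ring. Qed.

Lemma imquat_sqr x : imquat x *m imquat x = (- dot x x)%:C%:M.
Proof.
rewrite !imquatE quatM mx2_scalar dotE /diagpart /offdiag /quat !conjcE.
by congr mx2; apply/eqP; rewrite eq_complex /=; apply/andP; split; apply/eqP;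
  ring.
Qed.

Lemma quaternion_imquat x : quaternion (imquat x).
Proof. by apply/quaternionP; rewrite imquatE; eexists; eexists. Qed.

Lemma quaternion_unitmx X : quaternion X -> X != 0 -> X \in unitmx.
Proof. by move=> /quaternionP[A [B ->]]; exact: quat_neq0. Qed.

(** For imaginary unit quaternions [e] and [n], the quaternion [1 - e n] satisfies
[e (1 - e n) = e + n = (1 - e n) n]. It vanishes only for [n = - e], where any
unit vector orthogonal to [e] does the job. *)
Lemma exists_frame n : unit_vector n ->
  exists X, [/\ quaternion X, X \in unitmx & imquat axis *m X = X *m imquat n].
Proof.
move=> n1.
have nn : imquat n *m imquat n = - 1%:M.
  by rewrite imquat_sqr n1 rmorphN raddfN.
have aa : imquat axis *m imquat axis = - 1%:M.
  by rewrite imquat_sqr dot_axis; have [_ _ ->] := axisE; rewrite rmorphN raddfN.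
pose X := 1%:M - imquat axis *m imquat n.
have XI : imquat axis *m X = X *m imquat n.
  rewrite /X mulmxBr mulmxBl mulmx1 mul1mx mulmxA aa -mulmxA nn.
  by rewrite mulNmx mulmxN mul1mx mulmx1 !opprK addrC.
have qX : quaternion X.
  apply/quaternionP; rewrite /X imquat_axis imquatE quatM -quat1.
  by rewrite quatN quatD; eexists; eexists.
have [X0|X0] := eqVneq X 0; last by exists X; split=> //; exact: quaternion_unitmx.
pose e := \row_(i < 3) (if i == 0 then 1 else 0 : R).
have ee : imquat e = quat 0 (- 'i%C).
  rewrite imquatE /diagpart /offdiag !mxE /=.
  by congr quat; apply/eqP; rewrite eq_complex; simpc; rewrite /= ?eqxx.
exists (imquat e); split; first exact: quaternion_imquat.
  rewrite ee; apply: quat_unit; rewrite [X in X != 0](_ : _ = 1) ?oner_eq0 //.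
  by rewrite !conjcE; apply: (lincomb1 (-1) (sqr_i R)); ring.
have -> : imquat n = - imquat axis.
  move: X0 => /eqP; rewrite /X subr_eq0 => /eqP h.
  by rewrite -[imquat n]mul1mx -[1%:M]opprK -aa mulNmx -mulmxA -h mulmx1.
by rewrite ee imquat_axis quatN !quatM !conjcE; congr quat; ring.
Qed.

Definition rotation_of X (rho : 'rV[R]_3 -> 'rV[R]_3) :=
  forall x, X *m imquat x = imquat (rho x) *m X.

Lemma quaternionV X : quaternion X -> quaternion (invmx X).
Proof.
move=> qX; have [uX|nuX] := boolP (X \in unitmx); last by rewrite invmx_out.
move: qX uX => /quaternionP[A [B ->]] uX.
pose N := A * A^J + B * B^J.
have NR : N = (complex.Re N)%:C.
  by rewrite RRe_real // ger0_real // addr_ge0 ?mulcJ_ge0.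
have N0 : N != 0.
  apply/negP; rewrite /N sum_mulJ_eq0 => /andP[/eqP A0 /eqP B0].
  have : quat A B *m invmx (quat A B) = 1%:M by rewrite mulmxV.
  rewrite {1}A0 {1}B0 quat00 mul0mx => /matrixP/(_ 0 0)/eqP.
  by rewrite !mxE eq_sym oner_eq0.
have -> : invmx (quat A B) = N^-1 *: quat A^J (- B).
  have h : quat A B *m (N^-1 *: quat A^J (- B)) = 1%:M.
    by rewrite -scalemxAr quat_adj scale_scalar_mx mulVf.
  by rewrite -[LHS]mulmx1 -h mulKmx.
by apply/quaternionP; rewrite NR -fmorphV quatZ; eexists; eexists.
Qed.

Lemma trace_imquat x : \tr (imquat x) = 0.
Proof.
rewrite imquatE trace_mx2 /diagpart; apply/eqP.
by rewrite eq_complex /= addr0 subrr eqxx.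
Qed.

Lemma quaternion_trace0 X : quaternion X -> \tr X = 0 -> exists x, X = imquat x.
Proof.
move=> [r [x ->]]; rewrite mxtraceD trace_imquat addr0 mxtrace_scalar => /eqP.
by rewrite mulrn_eq0 /= => /eqP ->; exists x; rewrite -scalemx1 scale0r add0r.
Qed.

(** Conjugation by a quaternion preserves trace-free quaternions. *)
Lemma exists_rotation X : quaternion X -> X \in unitmx ->
  exists rho, rotation_of X rho.
Proof.
move=> qX uX.
suff h x : exists y, X *m imquat x = imquat y *m X.
  by have [rho rhoP] := choice h; exists rho.
have [||y yE] := @quaternion_trace0 (X *m imquat x *m invmx X).
- by apply: quaternionM (quaternionV qX); apply: quaternionM (quaternion_imquat _).
- by rewrite mxtrace_mulC mulmxA mulVmx // mul1mx trace_imquat.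
by exists y; rewrite -yE mulmxKV.
Qed.

Section Rotation.
Variables (X : M2) (rho : 'rV[R]_3 -> 'rV[R]_3).
Hypotheses (uX : X \in unitmx) (rhoP : rotation_of X rho).

Let conjE x : imquat (rho x) = X *m imquat x *m invmx X.
Proof. by rewrite rhoP mulmxK. Qed.

Lemma rotation_unique x y : X *m imquat x = imquat y *m X -> rho x = y.
Proof.
rewrite rhoP => /(congr1 (fun Y => Y *m invmx X)); rewrite !mulmxK //.
exact: imquat_inj.
Qed.

Lemma rotationD x y : rho (x + y) = rho x + rho y.
Proof. by apply: rotation_unique; rewrite !imquatD mulmxDr mulmxDl !rhoP. Qed.

Lemma rotationZ (r : R) x : rho (r *: x) = r *: rho x.
Proof. by apply: rotation_unique; rewrite !imquatZ -scalemxAr -scalemxAl rhoP. Qed.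

Lemma rotationB x y : rho (x - y) = rho x - rho y.
Proof. by rewrite -scaleN1r rotationD rotationZ scaleN1r. Qed.

Lemma rotation0 : rho 0 = 0.
Proof. by rewrite -[0 in LHS](scale0r 0) rotationZ scale0r. Qed.

(** Scalar product and determinant are traces of products of imaginary
quaternions, and traces are invariant under conjugation. *)
Lemma dot_rotation x y : dot (rho x) (rho y) = dot x y.
Proof.
have : \tr (imquat (rho x) *m imquat (rho y)) = \tr (imquat x *m imquat y).
  rewrite !conjE mulmxA mxtrace_mulC !mulmxA mulVmx // mul1mx.
  by rewrite mulmxKV.
rewrite !trace_imquat2 => /complexI/(mulfI _) -> //.
Qed.

Lemma det3_rotation x y z : det3 (rho x) (rho y) (rho z) = det3 x y z.
Proof.
have : \tr (imquat (rho x) *m imquat (rho y) *m imquat (rho z)) =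
       \tr (imquat x *m imquat y *m imquat z).
  rewrite !conjE mulmxA mxtrace_mulC !mulmxA mulVmx // mul1mx.
  by rewrite !mulmxKV.
rewrite !trace_imquat3 => /complexI/(mulfI _) -> //.
Qed.

Lemma rotation_inj : injective rho.
Proof.
move=> x y h; apply: imquat_inj.
by apply: (can_inj (mulKmx uX)); rewrite !rhoP h.
Qed.
End Rotation.
End Frames.

(** * Transport of a frame along one edge, and around the quadrilateral *)

Section Edges.
Variable R : realType.
Local Notation C := R[i].
Local Notation M2 := 'M[R[i]]_2.
Implicit Types (a b c d A B : C) (x y z n f e : 'rV[R]_3) (X Y Z : M2).
Local Notation axis := (@axis R).

(** A value [X] of the frame together with its derivative [X'] with respect to [t],
in a form that is free of inverses. The derivative is normalized so that
[X^-1 X'] has trace zero. *)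
Definition frame_at X X' f n :=
  [/\ quaternion X, X \in unitmx, imquat axis *m X = X *m imquat n &
      2 *: X' = X *m imquat f].

(** The product of the two vertex variables of an edge with [n' - n = k (f' - f)]:
the unit number whose argument is [- 2 arctan k]. *)
Definition vertex_ratio (k : R) : C := (1 - 'i%C * k%:C) / (1 + 'i%C * k%:C).

Lemma oneDik_neq0 (k : R) : 1 + 'i%C * k%:C != 0 :> C.
Proof. by rewrite eq_complex; simpc; rewrite oner_eq0. Qed.

Lemma oneBik_neq0 (k : R) : 1 - 'i%C * k%:C != 0 :> C.
Proof. by rewrite eq_complex; simpc; rewrite oner_eq0. Qed.

Lemma vertex_ratioJ (k : R) : (vertex_ratio k)^J = (vertex_ratio k)^-1.
Proof.
rewrite /vertex_ratio !conjcE invf_div; congr (_ / _); ring.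
Qed.

Lemma vertex_ratio_neq0 (k : R) : vertex_ratio k != 0.
Proof. by rewrite mulf_neq0 ?invr_eq0 ?oneDik_neq0 ?oneBik_neq0. Qed.

Lemma vertex_ratio_inj : injective vertex_ratio.
Proof.
move=> k k' /eqP; rewrite eqr_div ?oneDik_neq0 // => /eqP h.
apply: (@complexI R).
apply: (mulfI (_ : 2 * 'i%C != 0 :> C)).
  by rewrite mulf_neq0 ?pnatr_eq0 // imaginary_neq0.
by apply: (lincomb1 (-1) h); ring.
Qed.

Lemma dot_eq0 x : (dot x x == 0) = (x == 0).
Proof.
apply/eqP/eqP => [|->]; last by rewrite dotE !mxE; ring.
rewrite dotE => h.
have h0 : x 0 0 = 0 by nra.
have h1 : x 0 1 = 0 by nra.
have h2 : x 0 2%:R = 0 by nra.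
apply: imquat_inj; rewrite !imquatE /diagpart /offdiag h0 h1 h2.
by rewrite !mxE.
Qed.

Lemma diagpartE x : diagpart x = - ('i%C * (x 0 2%:R)%:C).
Proof. by apply/eqP; rewrite eq_complex /diagpart; simpc. Qed.

Lemma offdiag_normE x :
  offdiag x * (offdiag x)^J + (x 0 2%:R)%:C ^+ 2 = (dot x x)%:C.
Proof.
rewrite dotE /offdiag; apply/eqP; rewrite eq_complex expr2; simpc => /=.
by apply/andP; split; apply/eqP; ring.
Qed.

(** The diagonal entry of the Lax matrix at [lambda = 1] of an edge with vector
[x], in a frame whose normal is the third axis. It is obtained by solving
[2 L' = L x] for the diagonal entry of [L], with the off-diagonal entries of
[L] and of its derivative [L'] given by [vertex_ratio k]. *)
Definition lax_diag (k : R) x : C :=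
  4 * 'i%C * (offdiag x)^J / ((1 + 'i%C * k%:C) * (dot x x)%:C).

(** The hypothesis [2 x_3 + k |x|^2 = 0] is the edge constraint in a frame whose
normal is the third axis. *)
Lemma lax_edge_vector (k : R) x : x != 0 -> 2 * x 0 2%:R + k * dot x x = 0 ->
  let w := vertex_ratio k in
  2 *: quat 0 ('i%C * (1 + w)) =
  quat (lax_diag k x) ('i%C * (1 - w)) *m imquat x.
Proof.
rewrite -dot_eq0 => x0 hx w.
have D0 : (dot x x)%:C != 0 :> C by rewrite (inj_eq (@complexI R) _ 0).
have h : 2 * (x 0 2%:R)%:C + k%:C * (dot x x)%:C = 0 :> C.
  by rewrite -(rmorph0 (real_complex R)) -hx rmorphD !rmorphM rmorph_nat.
have := offdiag_normE x; rewrite imquatE diagpartE /w /vertex_ratio /lax_diag.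
rewrite quat2Z quatM !conjcE.
move: (offdiag x) (x 0 2%:R)%:C (dot x x)%:C D0 h => b U D D0 h hD.
have := oneDik_neq0 k; have := mul_ii R.
move: ('i%C : C) k%:C h => i K h ii iK0.
set c := 4 * i / ((1 + i * K) * D).
congr quat.
  apply: (lincomb1 (2 * i ^+ 2 * b^J / ((1 + i * K) * D)) h).
  by field; rewrite D0 iK0.
apply: (lincomb3 (c * U / 2) (- c) (- c * K * U * D / 2) h hD ii).
by rewrite /c; field; rewrite D0 iK0.
Qed.

(** The commutator of [L] with the axis is [2 k L'], which by [lax_edge_vector]
is [k L x]. *)
Lemma lax_edge_normal (k : R) x : x != 0 -> 2 * x 0 2%:R + k * dot x x = 0 ->
  let w := vertex_ratio k in
  let L := quat (lax_diag k x) ('i%C * (1 - w)) in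
  imquat axis *m L = L *m imquat (axis + k *: x).
Proof.
move=> x0 hx w L; rewrite imquatD imquatZ mulmxDr -scalemxAr.
rewrite -(lax_edge_vector x0 hx) -/w quat2Z quatZ imquat_axis !quatM quatD.
rewrite !(mul0r, mulr0, conjc0) !conjcE.
have := mul_ii R; have := oneDik_neq0 k; rewrite /w /vertex_ratio.
move: ('i%C : C) k%:C (lax_diag k x) => i K a iK0 ii; congr quat; first by ring.
apply: (lincomb1 (- (4 * i * K / (1 + i * K))) ii).
by field.
Qed.

(** The first term on the right is [4 / sin^2 delta = (T + T^-1)^2] for
[T = tan (delta / 2)]; this is how the length of the edge fixes [delta]. *)
Lemma lax_diag_norm (k : R) x : x != 0 -> 2 * x 0 2%:R + k * dot x x = 0 ->
  let w := vertex_ratio k in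
  lax_diag k x * (lax_diag k x)^J =
  16 / ((1 + k ^+ 2) * dot x x)%:C - (2 - w - w^J).
Proof.
rewrite -dot_eq0 => x0 hx w.
have D0 : (dot x x)%:C != 0 :> C by rewrite (inj_eq (@complexI R) _ 0).
have h : 2 * (x 0 2%:R)%:C + k%:C * (dot x x)%:C = 0 :> C.
  by rewrite -(rmorph0 (real_complex R)) -hx rmorphD !rmorphM rmorph_nat.
have := offdiag_normE x; rewrite /w vertex_ratioJ /vertex_ratio /lax_diag.
rewrite !conjcE.
have -> : ((1 + k ^+ 2) * dot x x)%:C =
    (1 + 'i%C * k%:C) * (1 - 'i%C * k%:C) * (dot x x)%:C :> C.
  rewrite rmorphM rmorphD rmorph1 rmorphXn.
  by apply: (lincomb1 (k%:C ^+ 2 * (dot x x)%:C) (mul_ii R)); ring.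
move: (offdiag x) (x 0 2%:R)%:C (dot x x)%:C D0 h => b U D D0 h hD.
have := oneDik_neq0 k; have := oneBik_neq0 k; have := mul_ii R.
move: ('i%C : C) k%:C h => i K h ii iK' iK0.
(* [hD] eliminates [b b^J], [h] eliminates [U] and [ii] reduces [i^2] *)
set c := ((1 + i * K) * (1 - i * K) * D ^+ 2)^-1.
apply: (lincomb3 (- 16 * i ^+ 2 * c) (8 * i ^+ 2 * (U - K * D / 2) * c)
  (- 16 * D * c) hD h ii).
by rewrite /c; field; rewrite D0 iK0 iK'.
Qed.

(** The entry vanishes exactly if the edge is parallel to the normal, and then the
normals at the two ends are antipodal. *)
Lemma lax_diag_neq0 (k : R) x : x != 0 -> 2 * x 0 2%:R + k * dot x x = 0 ->
  2 *: axis + k *: x != 0 -> lax_diag k x != 0.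
Proof.
rewrite -dot_eq0 => x0 hx ns.
have D0 : (dot x x)%:C != 0 :> C by rewrite (inj_eq (@complexI R) _ 0).
rewrite /lax_diag !mulf_neq0 ?invr_eq0 ?mulf_neq0 ?oneDik_neq0 ?pnatr_eq0 //.
  exact: imaginary_neq0.
rewrite conjc_eq0; apply: contraNneq ns => /eqP.
rewrite eq_complex /= !oppr_eq0 => /andP[/eqP x1 /eqP x0'].
move: hx x0; rewrite dotE x1 x0' !mul0r !add0r mulf_eq0 orbb => hx x2.
apply/eqP; apply: imquat_inj; rewrite !imquatE /diagpart /offdiag !mxE /= x1 x0'.
congr quat; apply/eqP; rewrite eq_complex /= ?(mulr0, addr0, oppr0) ?eqxx //=.
rewrite oppr_eq0 mulr1; apply/eqP; apply: (mulIf x2); rewrite mul0r -hx; ring.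
Qed.

Lemma quat_lax_unit a b : a != 0 -> quat a b \in unitmx.
Proof. by move=> a0; apply: quat_unit; rewrite sum_mulJ_eq0 negb_and a0. Qed.

(** The rotation of the frame reduces the general edge to one in a frame whose
normal is the third axis. *)
Lemma frame_at_edge X X' f n e (k : R) :
    frame_at X X' f n -> e != 0 ->
    dot e (n + (n + k *: e)) = 0 -> n + (n + k *: e) != 0 ->
  let w := vertex_ratio k in
  exists a, [/\ a != 0,
    a * a^J = 16 / ((1 + k ^+ 2) * dot e e)%:C - (2 - w - w^J) &
    frame_at (quat a ('i%C * (1 - w)) *m X)
      (quat 0 ('i%C * (1 + w)) *m X + quat a ('i%C * (1 - w)) *m X')
      (f + e) (n + k *: e)].
Proof.
move=> [qX uX Xn Xf] e0 he hs w.
have [rho rhoP] := exists_rotation qX uX.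
have rn : rho n = axis by apply: (rotation_unique uX rhoP); rewrite Xn.
have re0 : rho e != 0.
  apply: contra_neq e0 => h; apply: (rotation_inj uX rhoP).
  by rewrite h (rotation0 uX rhoP).
have hx : 2 * rho e 0 2%:R + k * dot (rho e) (rho e) = 0.
  have h : dot (rho e) (rho (n + (n + k *: e))) = 0.
    by rewrite (dot_rotation uX rhoP).
  move: h; rewrite !(rotationD uX rhoP) (rotationZ uX rhoP) rn => h.
  move: h; rewrite !dotE !mxE /= => h.
  rewrite -h; ring.
have a0 : lax_diag k (rho e) != 0.
  apply: lax_diag_neq0 => //; apply: contra_neq hs => h.
  apply: (rotation_inj uX rhoP).
  rewrite !(rotationD uX rhoP) (rotationZ uX rhoP) rn.
  by rewrite (rotation0 uX rhoP) -h addrA scaler_nat mulr2n.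
exists (lax_diag k (rho e)); split=> //.
  by rewrite lax_diag_norm // (dot_rotation uX rhoP).
set L := quat (lax_diag k (rho e)) _.
have uL : L \in unitmx by exact: quat_lax_unit.
split.
- by apply: quaternionM qX; apply/quaternionP; eexists; eexists.
- by rewrite unitmx_mul uL uX.
- rewrite mulmxA lax_edge_normal // -mulmxA -mulmxA -/w -/L; congr (L *m _).
  by rewrite rhoP (rotationD uX rhoP) (rotationZ uX rhoP) rn.
- rewrite imquatD mulmxDr scalerDr addrC scalemxAr Xf mulmxA; congr (_ + _).
  by rewrite scalemxAl (lax_edge_vector re0 hx) -/w -/L -mulmxA -rhoP mulmxA.
Qed.

(** The quotient of two frames with the same normal commutes with the axis, hence
is diagonal. *)
Lemma frame_at_unique X1 X1' X2 X2' f n :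
    frame_at X1 X1' f n -> frame_at X2 X2' f n ->
  exists z : C, X1 = quat z 0 *m X2 /\ X1' = quat z 0 *m X2'.
Proof.
move=> [q1 u1 n1 f1] [q2 u2 n2 f2].
have [Z qZ ZE] : exists2 Z, quaternion Z & X1 = Z *m X2.
  exists (X1 *m invmx X2); rewrite ?mulmxKV //.
  exact: quaternionM (quaternionV q2).
have Zc : imquat axis *m Z = Z *m imquat axis.
  by apply: (can_inj (mulmxK u2)); rewrite -!mulmxA n2 -ZE mulmxA -ZE n1.
have /quaternionP[z [z' Zq]] := qZ.
have z'0 : z' = 0.
  move: Zc; rewrite Zq imquat_axis !quatM => /quat_inj[_]; rewrite !conjcE => h.
  apply: (mulfI (_ : 2 * 'i%C != 0 :> C)).
    by rewrite mulf_neq0 ?pnatr_eq0 // imaginary_neq0.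
  by apply: (lincomb1 (-1) h); ring.
exists z; rewrite -z'0 -Zq; split=> //.
apply: (can_inj (scalerK (_ : 2 != 0 :> C))); first by rewrite pnatr_eq0.
by rewrite scalemxAr f1 f2 mulmxA -ZE.
Qed.

Definition lax_quat (a w : C) (la : C) : M2 := quat a ('i%C * (la - w / la)).

(** The diagonal entry of the derivative at [1] is proportional to [1 - q] on both
sides, where [q = v1 / w = w2 / v]; hence [z = 1] unless [q = 1]. If [q = 1]
and [w != v], the off-diagonal entries force the derivative to vanish
altogether. Once [z = 1], the sum and the difference of the off-diagonal
entries of value and derivative give the coefficients of [lambda] and
[lambda^-1]. *)
Lemma lax_compatible_at1 (a c c1 a2 w v v1 w2 z la : R[i]) :
    [/\ w^J = w^-1, v^J = v^-1, w != 0 & v != 0] -> w * w2 = v * v1 ->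
    ~ [/\ w = v, v1 = w & w2 = v] ->
    lax_quat c1 v1 1 *m lax_quat a w 1 =
      quat z 0 *m (lax_quat a2 w2 1 *m lax_quat c v 1) ->
    quat 0 ('i%C * (1 + v1)) *m lax_quat a w 1 +
      lax_quat c1 v1 1 *m quat 0 ('i%C * (1 + w)) =
      quat z 0 *m (quat 0 ('i%C * (1 + w2)) *m lax_quat c v 1 +
      lax_quat a2 w2 1 *m quat 0 ('i%C * (1 + v))) ->
    quat 0 ('i%C * (1 + v1)) *m lax_quat a w 1 +
      lax_quat c1 v1 1 *m quat 0 ('i%C * (1 + w)) != 0 ->
    la^J = la -> la != 0 ->
  lax_quat c1 v1 la *m lax_quat a w la = lax_quat a2 w2 la *m lax_quat c v la.
Proof.
move=> [wJ vJ w0 v0] wv nwv.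
rewrite /lax_quat !divr1 !quatM !quatD !quatM !conjcE wJ vJ.
move=> /quat_inj[eA eB] /quat_inj[dA dB] d0 laR la0.
have qE : v1 / w = w2 / v by apply/eqP; rewrite eqr_div // mulrC -wv mulrC.
have i0 := imaginary_neq0 R.
have two : 2 != 0 :> C by rewrite pnatr_eq0.
have dA' : (1 - v1 / w) * (1 - z) = 0.
  apply: (mulfI (mulf_neq0 two (mulf_neq0 i0 i0))).
  by apply: (lincomb2 1 (z * 2 * ('i%C * 'i%C)) dA qE); field; rewrite v0 w0.
have [q1|q1] := eqVneq (1 - v1 / w) 0.
  have v1E : v1 = w by apply: (lincomb1 (- w) q1); field.
  have w2E : w2 = v.
    by apply: (lincomb2 (- v) (- v) q1 qE); field; rewrite v0 w0.
  have wv_neq : w - v != 0.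
    by apply/eqP => /eqP; rewrite subr_eq0 => /eqP wvE; apply: nwv.
  have r0 : c1 + a^J = 0.
    apply: (mulfI (_ : 2 * 'i%C * (w - v) != 0)).
      by rewrite !mulf_neq0.
    apply: (lincomb2 (- 1 - v) (1 - v) eB dB); rewrite v1E w2E; ring.
  case/eqP: d0; rewrite -quat00 v1E; congr quat; first by field.
  by apply: (lincomb1 ('i%C * (1 + w)) r0); ring.
have z1 : z = 1.
  move: dA' => /eqP; rewrite mulf_eq0 (negbTE q1) /= subr_eq0 => /eqP <- //.
move: eA eB dB; rewrite z1 => eA eB dB.
have rE : c1 + a^J = a2 + c^J.
  by apply: (mulfI (mulf_neq0 two i0)); apply: (lincomb2 1 1 eB dB); ring.
have uE : c1 * w + v1 * a^J = a2 * v + w2 * c^J.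
  by apply: (mulfI (mulf_neq0 two i0)); apply: (lincomb2 (-1) 1 eB dB); ring.
rewrite laR; congr quat.
  apply: (lincomb2 1 ('i%C * 'i%C * (la ^- 2 - 1)) eA qE); field.
  by rewrite v0 w0 la0.
apply: (lincomb2 ('i%C * la) (- 'i%C / la) rE uE); field.
exact: la0.
Qed.
End Edges.

(** * Spectral parameters and edge variables *)

Section LaxParameter.
Variable R : realType.
Local Notation C := R[i].
Implicit Types (z : C) (x y : R).

Lemma cexpD z z' : cexp (z + z') = cexp z * cexp z' :> C.
Proof.
case: z z' => a b [c d]; rewrite /cexp /= expRD cosD sinD.
by apply/eqP; rewrite eq_complex; simpc => /=; apply/andP; split; apply/eqP; ring.
Qed.

Lemma cexp0 : cexp 0 = 1 :> C.
Proof. by rewrite /cexp /= expR0 cos0 sin0; simpc. Qed.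

Lemma cexpN z : cexp z * cexp (- z) = 1 :> C.
Proof. by rewrite -cexpD subrr cexp0. Qed.

Lemma csin_double z : csin z = 2 * csin (z / 2) * ccos (z / 2).
Proof.
have zE : 'i%C * z = 'i%C * (z / 2) + 'i%C * (z / 2) by field.
rewrite /csin /ccos zE opprD !cexpD.
by field; rewrite ?pnatr_eq0 ?(imaginary_neq0 R).
Qed.

Lemma csin2Dccos2 z : csin z ^+ 2 + ccos z ^+ 2 = 1.
Proof.
rewrite /csin /ccos.
have h := cexpN ('i%C * z); have ii : 'i%C ^+ 2 = -1 :> C := sqr_i R.
have i0 := imaginary_neq0 R.
rewrite !expr_div_n exprMn ii.
by apply: (lincomb1 1 h); field.
Qed.

(** With [T = tan (z / 2)] this is [sin z = 2 T / (1 + T^2)]. *)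
Lemma ctan_half z : csin z != 0 ->
  [/\ csin (z / 2) != 0, ccos (z / 2) != 0, ctan (z / 2) != 0 &
      ctan (z / 2) + (ctan (z / 2))^-1 = 2 / csin z].
Proof.
rewrite csin_double => h.
have s0 : csin (z / 2) != 0 by apply: contraNneq h => ->; rewrite mulr0 mul0r.
have c0 : ccos (z / 2) != 0 by apply: contraNneq h => ->; rewrite mulr0.
split=> //; first by rewrite mulf_neq0 ?invr_eq0.
rewrite /ctan; have := csin2Dccos2 (z / 2).
move: (csin _) (ccos _) s0 c0 => s c s0 c0 sc.
apply: (lincomb1 (s * c)^-1 sc); field.
by rewrite s0 c0.
Qed.

Lemma csin_real x : csin (x%:C : C) = (sin x)%:C.
Proof.
have i0 := imaginary_neq0 R; have ii := sqr_i R.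
have e (r : R) : cexp ('i%C * r%:C) = (cos r)%:C + 'i%C * (sin r)%:C :> C.
  by rewrite /cexp; simpc => /=; rewrite expR0 !mul1r.
have eN : - ('i%C * x%:C) = 'i%C * (- x)%:C :> C by rewrite rmorphN mulrN.
by rewrite /csin eN !e cosN sinN rmorphN; field.
Qed.

Lemma csin_pihalf_imaginary y :
  csin ((pi / 2) +i* y : C) = ((expR y + expR (- y)) / 2)%:C.
Proof.
have i0 := imaginary_neq0 R.
have e (a b : R) : cexp ('i%C * (a +i* b)) =
    (expR (- b))%:C * ((cos a)%:C + 'i%C * (sin a)%:C) :> C.
  by rewrite /cexp; simpc.
have eN : - ('i%C * (pi / 2 +i* y)) = 'i%C * (- (pi / 2) +i* - y) :> C by simpc.
rewrite /csin eN !e cosN sinN cos_pihalf sin_pihalf opprK rmorphN rmorph1.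
rewrite rmorph0 rmorphM rmorphD fmorphV rmorph_nat.
by field.
Qed.

(** A value up to [1] is attained on the real axis. Larger values are attained on
the line [pi / 2 + i y], where the sine is [cosh y]; the argument of the
logarithm below is the solution of [cosh y = s]. *)
Lemma exists_csin (s : R) : 0 < s ->
  exists2 delta : C, csin delta = s%:C & lax_parameter delta.
Proof.
move=> s0; have [s1|s1] := leP s 1.
  have sE : sin (asin s) = s.
    by apply: asinK; rewrite in_itv /= s1 andbT (le_trans _ (ltW s0)) // lerN10.
  exists (asin s)%:C; first by rewrite csin_real sE.
  have [|sh0 ch0 _ _] := @ctan_half (asin s)%:C; last by left.
  by rewrite csin_real sE (inj_eq (@complexI R) _ 0) gt_eqF.
pose q := Num.sqrt (s ^+ 2 - 1).
have q2 : q ^+ 2 = s ^+ 2 - 1 by rewrite sqr_sqrtr // subr_ge0 exprn_ege1 // ltW.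
have p0 : 0 < s + q by rewrite ltr_wpDr ?sqrtr_ge0.
have E : csin ((pi / 2) +i* ln (s + q) : C) = s%:C.
  rewrite csin_pihalf_imaginary expRN lnK ?posrE //; congr (_ %:C).
  have h : (s + q) * (s - q) = 1 by rewrite mulrC -subr_sqr q2; ring.
  have -> : (s + q)^-1 = s - q.
    by apply: (mulfI (lt0r_neq0 p0)); rewrite mulfV ?lt0r_neq0.
  by field.
exists ((pi / 2) +i* ln (s + q)) => //.
by right; rewrite E.
Qed.

Lemma unit_normP z : `|z| = 1 <-> z * z^J = 1.
Proof.
rewrite -sqr_normc; split=> [->|/eqP]; first by rewrite expr1n.
by rewrite sqrp_eq1 ?normr_ge0 // => /eqP.
Qed.

Lemma unit_Re2DIm2 z : z * z^J = 1 -> complex.Re z ^+ 2 + complex.Im z ^+ 2 = 1.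
Proof. by move=> z1; apply: (@complexI R); rewrite add_Re2_Im2 sqr_normc. Qed.

Lemma cos_sin_carg z : z * z^J = 1 ->
  cos (carg z) = complex.Re z /\ sin (carg z) = complex.Im z.
Proof.
move=> z1; have h := unit_Re2DIm2 z1.
have n1 : Normc.normc z = 1.
  by apply: (@complexI R); rewrite -[LHS]/(`|z|); exact/unit_normP.
have x1 : -1 <= complex.Re z <= 1.
  by have := sqr_ge0 (complex.Im z) => ?; apply/andP; split; nra.
rewrite /carg n1 divr1.
have sE : Num.sqrt (1 - complex.Re z ^+ 2) = `|complex.Im z|.
  by rewrite -h addrC addKr sqrtr_sqr.
case: ifP => [y0|/negbT]; first by rewrite acosK // sin_acos // sE ger0_norm.
rewrite -ltNge => y0.
by rewrite cosN sinN acosK // sin_acos // sE ltr0_norm // opprK.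
Qed.

(** For a non-real [T] with [T + T^-1] real, [T^J] is the other root [T^-1] of the
same quadratic equation. *)
Lemma real_addV_norm z (r : R) : z != 0 -> complex.Im z != 0 ->
  z + z^-1 = r%:C -> z * z^J = 1.
Proof.
move=> z0 im0 h.
have hJ : z^J + (z^J)^-1 = z + z^-1 by rewrite -conjcV -conjcD h conjc_real.
have zJ : z^J != 0 by rewrite conjc_eq0.
have : (z - z^J) * (z * z^J - 1) = 0.
  by apply: (lincomb1 (- (z * z^J)) hJ); field; rewrite z0 zJ.
move=> /eqP; rewrite mulf_eq0 subcJ !mulf_eq0 (negbTE (imaginary_neq0 R)).
rewrite (inj_eq (@complexI R) _ 0) (negbTE im0) pnatr_eq0 /=.
by rewrite subr_eq0 => /eqP.
Qed.

Lemma Re_mulJ z z' : z * z'^J + z^J * z' =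
  2 * (complex.Re z * complex.Re z' + complex.Im z * complex.Im z')%:C.
Proof.
by case: z z' => a b [c d]; apply/eqP; rewrite eq_complex; simpc => /=;
  apply/andP; split; apply/eqP; ring.
Qed.

(** The diagonal entry is the edge variable times [P = T^-1 / s + T s'], so the edge
variable has to be [a / P]. The condition on [|a|^2] says [P Q = a a^J] for the
corresponding factor [Q] of the lower diagonal entry; this is what makes the
matrix a quaternion. The squared modulus of the edge variable is [Q / P^J]. It
is [1] for real [T]; for [|T| = 1] both [Q] and [P^J] become real after
multiplication by [(s + s') / s], twice the numerator and the denominator in
the formula for the modulus. *)
Lemma exists_lax_edge (delta T s s' a : C) (r : R) :
    let w := s * s' in ctan (delta / 2) = T ->
    T != 0 -> T + T^-1 = r%:C -> s * s^J = 1 -> s' * s'^J = 1 -> s + s' != 0 ->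
    a != 0 -> a * a^J = r%:C ^+ 2 - (2 - w - w^J) ->
  exists e, lax_edge delta e s s' /\
    forall lam : R, 0 < lam -> lax_matrix delta e s s' lam = lax_quat a w lam%:C.
Proof.
move=> w TE T0 Tr s1 s'1 ss' a0 aa.
have s0 : s != 0 by apply: contra_eq_neq s1 => ->; rewrite mul0r eq_sym oner_eq0.
have s'0 : s' != 0 by apply: contra_eq_neq s'1 => ->; rewrite mul0r eq_sym oner_eq0.
have sJ : s^J = s^-1 by apply: (mulfI s0); rewrite s1 mulfV.
have s'J : s'^J = s'^-1 by apply: (mulfI s'0); rewrite s'1 mulfV.
have aJ0 : a^J != 0 by rewrite conjc_eq0.
pose P := T^-1 / s + T * s'; pose Q := T^-1 * s + T / s'.
have PQ : P * Q = a * a^J.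
  rewrite aa /w -Tr /P /Q conjcM sJ s'J; field.
  by rewrite T0 s0 s'0.
have P0 : P != 0.
  by apply: contra_neq (mulf_neq0 a0 aJ0) => P0; rewrite -PQ P0 mul0r.
have Q0 : Q != 0.
  by apply: contra_neq (mulf_neq0 a0 aJ0) => Q0; rewrite -PQ Q0 mulr0.
have [e e0 eP] : exists2 e, e != 0 & e * P = a.
  by exists (a / P); rewrite ?divfK // mulf_neq0 ?invr_eq0.
have eaJ : e * a^J = Q by apply: (mulfI P0); rewrite PQ mulrA (mulrC P) eP.
have eeJ : e * e^J * P^J = Q by rewrite -mulrA -conjcM eP.
exists e; have LE (lam : R) : 0 < lam ->
    lax_matrix delta e s s' lam = lax_quat a w lam%:C.
  move=> lam0; have l0 : lam%:C != 0 :> C.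
    by rewrite (inj_eq (@complexI R) _ 0) gt_eqF.
  rewrite /lax_matrix /lax_quat /quat TE !conjcE sJ s'J.
  congr mx2.
  - by rewrite -eP /P; ring.
  - by rewrite /w; field; rewrite l0 s'0 s0.
  - by apply: (mulfI e0); rewrite eaJ /Q; field; rewrite e0 s'0 T0.
split=> //; split=> //; last first.
  by move=> lam lam0; rewrite LE //; apply/quaternionP; eexists; eexists.
rewrite normc_def; congr (_%:C).
have suffE (x : R) : x%:C = e * e^J ->
    complex.Re e ^+ 2 + complex.Im e ^+ 2 = x.
  by move=> h; apply: (@complexI R); rewrite add_Re2_Im2 sqr_normc.
rewrite /edge_modulus TE; case: ifPn => [/eqP imT|imT].
  have TJ : T^J = T.
    apply/eqP; rewrite eq_complex; move: imT; case: (T) => t u /= ->.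
    by rewrite oppr0 !eqxx.
  have PJ : P^J = Q.
    by rewrite /P /Q !conjcE TJ sJ s'J invrK.
  rewrite (suffE 1) ?sqrtr1 //; apply: (mulIf Q0).
  by rewrite mul1r -[in RHS]PJ eeJ.
have TT := real_addV_norm T0 imT Tr.
have TJ : T^J = T^-1 by apply: (mulfI T0); rewrite TT mulfV.
congr Num.sqrt; apply: suffE.
have [cs ss] := cos_sin_carg s1; have [cs' ss'E] := cos_sin_carg s'1.
have [cT sT] := cos_sin_carg TT.
have two : 2 != 0 :> C by rewrite pnatr_eq0.
set num := cos _ + cos _; set den := cos _ + cos _.
have numE : 2 * num%:C = (s + s') / s * Q.
  have -> : num = complex.Re (s + s') * complex.Re T +
      complex.Im (s + s') * complex.Im T.
    by rewrite /num !cosB cs ss cs' ss'E cT sT !raddfD /=; ring.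
  rewrite -Re_mulJ conjcD TJ sJ s'J /Q; field.
  by rewrite T0 s'0 s0.
have denE : 2 * den%:C = (s + s') / s * P^J.
  have -> : den = complex.Re (s + s') * complex.Re T^J +
      complex.Im (s + s') * complex.Im T^J.
    rewrite /den !cosD cs ss cs' ss'E cT sT !raddfD /=.
    by case: (T) => t u /=; ring.
  rewrite -Re_mulJ conjcK conjcD /P !conjcE TJ sJ s'J invrK; field.
  by rewrite T0 s'0 s0.
have fac0 : (s + s') / s != 0 by rewrite mulf_neq0 ?invr_eq0.
have den0 : den%:C != 0 :> C.
  have : 2 * den%:C != 0 :> C by rewrite denE mulf_neq0 // conjc_eq0.
  by rewrite mulf_eq0 negb_or => /andP[].
rewrite rmorphM fmorphV; apply: (mulIf den0); rewrite divfK //.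
apply: (mulfI two); rewrite numE mulrCA denE mulrCA eeJ //.
Qed.
End LaxParameter.

(** * Frames depending on the spectral parameter *)

Section LaurentFrames.
Variable R : realType.
Local Notation C := R[i].
Local Notation M2 := 'M[R[i]]_2.

(** Polynomials in [exp t] and [exp (- t)], paired with their derivatives. The
class is closed under differentiation, which gives smoothness. *)
Inductive exp_poly : (R -> R) -> (R -> R) -> Prop :=
| ExpPolyConst c : exp_poly (fun=> c) (fun=> 0)
| ExpPolyExp : exp_poly expR expR
| ExpPolyExpN : exp_poly (fun t => expR (- t)) (fun t => - expR (- t))
| ExpPolyOpp u u' : exp_poly u u' -> exp_poly (fun t => - u t) (fun t => - u' t)
| ExpPolyAdd u u' v v' : exp_poly u u' -> exp_poly v v' ->
    exp_poly (fun t => u t + v t) (fun t => u' t + v' t)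
| ExpPolyMul u u' v v' : exp_poly u u' -> exp_poly v v' ->
    exp_poly (fun t => u t * v t) (fun t => u' t * v t + u t * v' t).

Lemma exp_poly_is_derive u u' : exp_poly u u' ->
  forall t : R, is_derive t 1 u (u' t).
Proof.
elim=> {u u'} [c||| u u' _ Hu|u u' v v' _ Hu _ Hv|u u' v v' _ Hu _ Hv] t.
- exact: is_derive_cst.
- exact: is_derive_expR.
- have -> : (fun t => expR (- t)) = expR \o (-%R : R -> R) by [].
  have -> : - expR (- t) = expR (- t) * (-1) by rewrite mulrN1.
  by apply: is_derive1_comp.
- exact: is_deriveN.
- exact: is_deriveD.
- by rewrite addrC (mulrC (u' t)); exact: is_deriveM (Hu t) (Hv t).
Qed.

Lemma exp_poly_derivative u u' : exp_poly u u' -> exists u'', exp_poly u' u''.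
Proof.
elim=> {u u'} [c|||u u' Eu [u'' Hu]|u u' v v' Eu [u'' Hu] Ev [v'' Hv]
  |u u' v v' Eu [u'' Hu] Ev [v'' Hv]]; eexists.
- exact: ExpPolyConst.
- exact: ExpPolyExp.
- exact: ExpPolyOpp ExpPolyExpN.
- exact: ExpPolyOpp Hu.
- exact: ExpPolyAdd Hu Hv.
- exact: ExpPolyAdd (ExpPolyMul Hu Ev) (ExpPolyMul Eu Hv).
Qed.

Lemma exp_poly_derive1 u u' : exp_poly u u' -> derive1 u = u'.
Proof.
move=> Eu; apply/funext => t; rewrite derive1E.
by have := exp_poly_is_derive Eu t => H; rewrite derive_val.
Qed.

Lemma exp_poly_smooth u u' : exp_poly u u' -> smooth u.
Proof.
move=> Eu k; suff [v [v' [-> Ev]]] : exists v v', derive1n k u = v /\ exp_poly v v'.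
  by move=> t; have := exp_poly_is_derive Ev t => H; exact: ex_derive.
elim: k => [|k [v [v' [IH Ev]]]]; first by exists u, u'; rewrite derive1n0.
have [v'' Ev'] := exp_poly_derivative Ev.
by exists v', v''; rewrite derive1nS IH (exp_poly_derive1 Ev).
Qed.

(** [F] is, in the variable [t] with [lambda = e^t], a complex function of the
class [exp_poly], with derivative [d] at [t = 0]. *)
Definition laurent (F : R -> C) (d : C) := exists u u' v v',
  [/\ exp_poly u u', exp_poly v v', forall t, F (expR t) = u t +i* v t &
      d = u' 0 +i* v' 0].

Lemma laurent_cst c : laurent (fun=> c) 0.
Proof.
exists (fun=> complex.Re c), (fun=> 0), (fun=> complex.Im c), (fun=> 0); split=> //.
- exact: ExpPolyConst.
- exact: ExpPolyConst.
- by case: c.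
Qed.

Lemma laurent_id : laurent (fun l => l%:C) 1.
Proof.
exists expR, expR, (fun=> 0), (fun=> 0); split=> //.
- exact: ExpPolyExp.
- exact: ExpPolyConst.
- by rewrite expR0.
Qed.

Lemma laurent_inv : laurent (fun l => l%:C^-1) (- 1).
Proof.
exists (fun t => expR (- t)), (fun t => - expR (- t)), (fun=> 0), (fun=> 0).
split=> //.
- exact: ExpPolyExpN.
- exact: ExpPolyConst.
- by move=> t; rewrite -fmorphV expRN.
- by rewrite oppr0 expR0; apply/eqP; rewrite eq_complex /= oppr0 !eqxx.
Qed.

Lemma laurentD F G d e : laurent F d -> laurent G e ->
  laurent (fun l => F l + G l) (d + e).
Proof.
move=> [u [u' [v [v' [Eu Ev FE ->]]]]] [x [x' [y [y' [Ex Ey GE ->]]]]].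
eexists _, _, _, _; split; [exact: ExpPolyAdd Eu Ex|exact: ExpPolyAdd Ev Ey| |by []].
by move=> t; rewrite FE GE.
Qed.

Lemma laurentN F d : laurent F d -> laurent (fun l => - F l) (- d).
Proof.
move=> [u [u' [v [v' [Eu Ev FE ->]]]]].
eexists _, _, _, _; split; [exact: ExpPolyOpp Eu|exact: ExpPolyOpp Ev| |by []].
by move=> t; rewrite FE.
Qed.

Lemma laurentJ F d : laurent F d -> laurent (fun l => (F l)^J) (d^J).
Proof.
move=> [u [u' [v [v' [Eu Ev FE ->]]]]].
eexists _, _, _, _; split; [exact: Eu|exact: ExpPolyOpp Ev| |by []].
by move=> t; rewrite FE.
Qed.

Lemma laurentM F G d e : laurent F d -> laurent G e ->
  laurent (fun l => F l * G l) (d * G 1 + F 1 * e).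
Proof.
move=> [u [u' [v [v' [Eu Ev FE ->]]]]] [x [x' [y [y' [Ex Ey GE ->]]]]].
eexists _, _, _, _; split;
  [exact: ExpPolyAdd (ExpPolyMul Eu Ex) (ExpPolyOpp (ExpPolyMul Ev Ey))|
   exact: ExpPolyAdd (ExpPolyMul Eu Ey) (ExpPolyMul Ev Ex)| |].
  by move=> t; rewrite FE GE.
rewrite -(expR0 R) FE GE; apply/eqP; rewrite eq_complex; simpc => /=.
by apply/andP; split; apply/eqP; ring.
Qed.

Definition laurent_frame (Phi : R -> M2) (D : M2) :=
  forall i j, laurent (fun l => Phi l i j) (D i j).

Lemma laurent_frameM Phi Psi D E : laurent_frame Phi D -> laurent_frame Psi E ->
  laurent_frame (fun l => Phi l *m Psi l) (D *m Psi 1 + Phi 1 *m E).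
Proof.
move=> HD HE i j.
have H := laurentD (laurentM (HD i 0) (HE 0 j)) (laurentM (HD i 1) (HE 1 j)).
have mulE (A B : M2) : (A *m B) i j = A i 0 * B 0 j + A i 1 * B 1 j.
  rewrite mxE 2!big_ord_recl big_ord0 addr0.
  by congr (_ + A i _ * B _ j); apply: val_inj.
have <- : (fun l => Phi l i 0 * Psi l 0 j + Phi l i 1 * Psi l 1 j) =
          (fun l => (Phi l *m Psi l) i j).
  by apply/funext => l; rewrite mulE.
rewrite [_ i j](_ : _ = (D *m Psi 1) i j + (Phi 1 *m E) i j); last by rewrite mxE.
rewrite !mulE; move: H; congr laurent; ring.
Qed.

Lemma laurent_frame_quat F G d e : laurent F d -> laurent G e ->
  laurent_frame (fun l => quat (F l) (G l)) (quat d e).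
Proof.
move=> HF HG; elim/ord2P; elim/ord2P.
- rewrite [quat _ _ _ _]mxE /=.
  by have -> : (fun l => quat (F l) (G l) 0 0) = F by apply/funext=> l; rewrite mxE.
- rewrite [quat _ _ _ _]mxE /=.
  by have -> : (fun l => quat (F l) (G l) 0 1) = G by apply/funext=> l; rewrite mxE.
- rewrite [quat _ _ _ _]mxE /=.
  have -> : (fun l => quat (F l) (G l) 1 0) = (fun l => - (G l)^J).
    by apply/funext=> l; rewrite mxE.
  exact: laurentN (laurentJ HG).
- rewrite [quat _ _ _ _]mxE /=.
  have -> : (fun l => quat (F l) (G l) 1 1) = (fun l => (F l)^J).
    by apply/funext=> l; rewrite mxE.
  exact: laurentJ HF.
Qed.

Lemma laurent_frame_smooth Phi D : laurent_frame Phi D -> smooth_frame Phi.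
Proof.
move=> H i j; have [u [u' [v [v' [Eu Ev FE _]]]]] := H i j; split.
  have -> : entry_re Phi i j = u by apply/funext => t; rewrite /entry_re FE.
  exact: exp_poly_smooth Eu.
have -> : entry_im Phi i j = v by apply/funext => t; rewrite /entry_im FE.
exact: exp_poly_smooth Ev.
Qed.

Lemma laurent_frame_dt Phi D : laurent_frame Phi D -> dt Phi 0 = D.
Proof.
move=> H; apply/matrixP => i j; rewrite mxE.
have [u [u' [v [v' [Eu Ev FE ->]]]]] := H i j.
have -> : entry_re Phi i j = u by apply/funext => t; rewrite /entry_re FE.
have -> : entry_im Phi i j = v by apply/funext => t; rewrite /entry_im FE.
by rewrite (exp_poly_derive1 Eu) (exp_poly_derive1 Ev).
Qed.

Lemma laurent_frame_lax (a w : C) :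
  laurent_frame (fun l => lax_quat a w l%:C) (quat 0 ('i%C * (1 + w))).
Proof.
apply: laurent_frame_quat; first exact: laurent_cst.
have := laurentM (laurent_cst 'i%C) (laurentD laurent_id
  (laurentN (laurentM (laurent_cst w) laurent_inv))).
by congr laurent; rewrite !rmorph1; ring.
Qed.

Lemma laurent_frame_cst X : laurent_frame (fun=> X) 0.
Proof. by move=> i j; rewrite mxE; exact: laurent_cst. Qed.

(** At [lambda = 1] this frame has value [X] and derivative [X f / 2]; it is
invertible because [f] is imaginary. *)
Definition base_frame (X : M2) (f : 'rV[R]_3) (l : R) : M2 :=
  X *m (1%:M + ((l - 1) / 2)%:C *: imquat f).

Lemma base_frame1 X f : base_frame X f 1 = X.
Proof. by rewrite /base_frame subrr mul0r scale0r addr0 mulmx1. Qed.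

Lemma imquat_addr1_unit (r : R) (f : 'rV[R]_3) :
  quaternion (1%:M + r%:C *: imquat f) /\ 1%:M + r%:C *: imquat f \in unitmx.
Proof.
have q : quaternion (1%:M + r%:C *: imquat f).
  by exists 1, (r *: f); rewrite imquatZ rmorph1.
split=> //; apply: quaternion_unitmx => //.
apply/eqP => /(congr1 mxtrace).
rewrite mxtraceD mxtraceZ trace_imquat mulr0 addr0 mxtrace1 linear0 => /eqP.
by rewrite pnatr_eq0.
Qed.

Lemma laurent_base_frame X f :
  laurent_frame (base_frame X f) (X *m (2^-1 *: imquat f)).
Proof.
have [A [B fE]] : exists A B, imquat f = quat A B.
  by exists (diagpart f), (offdiag f); rewrite imquatE.
pose F (z l : R[i]) := (l + -1) * 2^-1 * z.
have FL z : laurent (fun l => F z l%:C) (2^-1 * z).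
  have := laurentM (laurentM (laurentD laurent_id (laurent_cst (- 1)))
    (laurent_cst 2^-1)) (laurent_cst z).
  by congr laurent; rewrite rmorph1; ring.
have H := laurent_frameM (laurent_frame_cst X)
  (laurent_frame_quat (laurentD (laurent_cst 1) (FL A)) (FL B)).
have two : (2^-1)%:C = 2^-1 :> C by rewrite fmorphV rmorph_nat.
have E1 : (fun l : R => X *m quat (1 + F A l%:C) (F B l%:C)) = base_frame X f.
  apply/funext => l; rewrite /F /base_frame fE quatZ -quat1 quatD add0r.
  have -> // : ((l - 1) / 2)%:C = (l%:C + -1) * 2^-1 :> C.
  by rewrite rmorphM rmorphB rmorph1 fmorphV rmorph_nat.
rewrite -E1; move: H; congr (laurent_frame _ _).
by rewrite mul0mx !add0r fE -two quatZ.
Qed.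

Lemma frame_represents_at (Phi : R -> M2) D X X' f n :
  laurent_frame Phi D -> Phi 1 = X -> D = X' -> frame_at X X' f n ->
  frame_represents Phi f n.
Proof.
move=> HD PX DX [qX uX Xn Xf]; split.
  rewrite /frame_point (laurent_frame_dt HD) PX DX.
  have -> : invmx X *m X' = 2^-1 *: imquat f.
    apply: (can_inj (scalerK (_ : 2 != 0 :> C))); first by rewrite pnatr_eq0.
    by rewrite scalemxAr Xf mulKmx // scalerA mulfV ?scale1r // pnatr_eq0.
  rewrite /tracefree mxtraceZ trace_imquat mulr0 mul0r raddf0 subr0.
  by rewrite scalerA mulfV ?scale1r // pnatr_eq0.
rewrite /frame_normal PX -mulmxA scalemxAr scalemxAl -imquat_axis_sigma3.
by rewrite Xn mulKmx.
Qed.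
End LaurentFrames.

(** * Circular quadrilaterals in space *)

Section Quadrilateral.
Variable R : realType.
Local Notation C := R[i].
Local Notation M2 := 'M[R[i]]_2.
Implicit Types (x y f n c u : 'rV[R]_3).

Definition planar_coord x : C := x 0 0 +i* x 0 1.

Lemma planar_coordD x y : planar_coord (x + y) = planar_coord x + planar_coord y.
Proof. by rewrite /planar_coord !mxE. Qed.

Lemma planar_coordB x y : planar_coord (x - y) = planar_coord x - planar_coord y.
Proof. by rewrite /planar_coord !mxE. Qed.

Lemma planar_coordZ (r : R) x : planar_coord (r *: x) = r%:C * planar_coord x.
Proof. by rewrite /planar_coord !mxE; simpc. Qed.

Lemma planar_coord_norm x : x 0 2%:R = 0 ->
  planar_coord x * (planar_coord x)^J = (dot x x)%:C.
Proof.
move=> x2; rewrite dotE x2 /planar_coord; apply/eqP.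
by rewrite eq_complex /=; apply/andP; split; apply/eqP; ring.
Qed.

Lemma planar_coord_inj x y : x 0 2%:R = y 0 2%:R ->
  planar_coord x = planar_coord y -> x = y.
Proof.
move=> e2 [e0 e1]; apply: imquat_inj.
by rewrite !imquatE /diagpart /offdiag e0 e1 e2.
Qed.

Lemma bracket_planar_coord x y n : x 0 2%:R = 0 -> y 0 2%:R = 0 ->
  bracket (planar_coord x) (planar_coord y) * (n 0 2%:R)%:C =
  2 * 'i%C * (det3 x y n)%:C.
Proof.
move=> x2 y2; rewrite det3E x2 y2 /bracket /planar_coord; apply/eqP.
by rewrite eq_complex /=; apply/andP; split; apply/eqP; ring.
Qed.

Lemma subr_telescope x y n : (y - x) + (n - y) = n - x.
Proof. by rewrite [LHS]addrC addrA subrK. Qed.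

(** The rotation that carries the axis of the circle to the third axis identifies
the plane of the circle with the complex numbers. The edges and the differences
of the normals lie in that plane, so both determinants in the curvature are area
forms times the same component of [N], which cancels. *)
Lemma circular_quad_closing (f f1 f12 f2 n n1 n12 n2 N : 'rV[R]_3)
    (k1 k2 k3 k4 : R) :
    circular_quad f f1 f12 f2 ->
    [/\ n1 - n = k1 *: (f1 - f), n12 - n1 = k2 *: (f12 - f1),
        n2 - n12 = k3 *: (f2 - f12) & n - n2 = k4 *: (f - f2)] ->
    gauss_curvature f f1 f12 f2 n n1 n12 n2 N = -1 ->
  [/\ (1 + k1 ^+ 2) * dot (f1 - f) (f1 - f) =
      (1 + k3 ^+ 2) * dot (f2 - f12) (f2 - f12),
      (1 + k2 ^+ 2) * dot (f12 - f1) (f12 - f1) =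
      (1 + k4 ^+ 2) * dot (f - f2) (f - f2),
      (1 - k1 * k3) * (k2 + k4) = (1 - k2 * k4) * (k1 + k3) &
      ~ [/\ k1 = k2, k2 = k3 & k3 = k4]].
Proof.
move=> [uniqf [c [u [r [u1 r0 onC]]]]] [h1 h2 h3 h4].
rewrite /gauss_curvature => hK.
have [X [qX uX Xu]] := exists_frame u1.
have [rho rhoP] := exists_rotation qX uX.
have ru : rho u = axis R by apply: (rotation_unique uX rhoP); rewrite Xu.
have rhoB := rotationB uX rhoP; have rhoD := rotationD uX rhoP.
have rhoZ := rotationZ uX rhoP; have dotr := dot_rotation uX rhoP.
pose g x := planar_coord (rho x).
have gD x y : g (x + y) = g x + g y by rewrite /g rhoD planar_coordD.
have gB x y : g (x - y) = g x - g y by rewrite /g rhoB planar_coordB.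
have gZ a x : g (a *: x) = a%:C * g x by rewrite /g rhoZ planar_coordZ.
have flat x : dot x u = 0 -> rho x 0 2%:R = 0 by rewrite -dotr ru dot_axis.
have dotB x y : dot (x - y) u = dot (x - c) u - dot (y - c) u.
  by rewrite !dotE !mxE; ring.
have onp p q : p \in [:: f; f1; f12; f2] -> q \in [:: f; f1; f12; f2] ->
    dot (p - q) u = 0.
  by move=> /onC[_ hp] /onC[_ hq]; rewrite dotB hp hq subrr.
have [i0 i1 i12 i3] : [/\ f \in [:: f; f1; f12; f2], f1 \in [:: f; f1; f12; f2],
    f12 \in [:: f; f1; f12; f2] & f2 \in [:: f; f1; f12; f2]].
  by rewrite !inE !eqxx !orbT.
have gN p : p \in [:: f; f1; f12; f2] -> g (p - c) * (g (p - c))^J = (r ^+ 2)%:C.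
  by move=> /onC[h /flat h']; rewrite /g planar_coord_norm // dotr h.
have gI p q : p \in [:: f; f1; f12; f2] -> q \in [:: f; f1; f12; f2] ->
    g (p - c) = g (q - c) -> p = q.
  move=> hp hq /planar_coord_inj h; apply: (addIr (- c)).
  apply: (rotation_inj uX rhoP); apply: h.
  by rewrite !flat //; have [] := onC _ hp; have [] := onC _ hq.
have gE p q : g (p - c) - g (q - c) = g (p - q).
  by rewrite -gB; congr g; rewrite opprB addrA subrK.
have rho0 : (r ^+ 2)%:C != 0 :> C.
  by rewrite (inj_eq (@complexI R) _ 0) expf_neq0 // gt_eqF.
have uniqg : uniq [:: g (f - c); g (f1 - c); g (f12 - c); g (f2 - c)].
  rewrite -[X in uniq X]/(map (fun p => g (p - c)) [:: f; f1; f12; f2]).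
  by rewrite map_inj_in_uniq // => p q; exact: gI.
have ge p q : p \in [:: f; f1; f12; f2] -> q \in [:: f; f1; f12; f2] ->
    g (p - q) * (g (p - q))^J = (dot (p - q) (p - q))%:C.
  by move=> hp hq; rewrite /g planar_coord_norm ?dotr // flat // onp.
have det_ne0 : det3 (f12 - f) (f2 - f1) N != 0.
  apply/eqP => d0; move: hK; rewrite d0 invr0 mulr0 => /eqP.
  by rewrite eq_sym oppr_eq0 oner_eq0.
have detK : det3 (n12 - n) (n2 - n1) N = - det3 (f12 - f) (f2 - f1) N.
  apply: (mulIf (_ : (det3 (f12 - f) (f2 - f1) N)^-1 != 0)).
    by rewrite invr_eq0.
  by rewrite hK mulNr mulfV.
have nE : n12 - n = k1 *: (f1 - f) + k2 *: (f12 - f1).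
  by rewrite -h1 -h2 subr_telescope.
have nE' : n2 - n1 = k2 *: (f12 - f1) + k3 *: (f2 - f12).
  by rewrite -h3 -h2 subr_telescope.
have br x y : dot x u = 0 -> dot y u = 0 ->
    bracket (g x) (g y) * (rho N 0 2%:R)%:C = 2 * 'i%C * (det3 x y N)%:C.
  by move=> hx hy; rewrite /g bracket_planar_coord ?flat // (det3_rotation uX rhoP).
have dotL a b x y : dot x u = 0 -> dot y u = 0 -> dot (a *: x + b *: y) u = 0.
  by rewrite !dotE !mxE => hx hy; apply: (lincomb2 a b hx hy); ring.
have brf := br (f12 - f) (f2 - f1) (onp _ _ i12 i0) (onp _ _ i3 i1).
have brn : bracket (g (n12 - n)) (g (n2 - n1)) * (rho N 0 2%:R)%:C =
    2 * 'i%C * (det3 (n12 - n) (n2 - n1) N)%:C.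
  by apply: br; rewrite ?nE ?nE'; apply: dotL; apply: onp.
have two_i : 2 * 'i%C != 0 :> C by rewrite mulf_neq0 ?pnatr_eq0 ?(imaginary_neq0 R).
have brfN0 : bracket (g (f12 - f)) (g (f2 - f1)) * (rho N 0 2%:R)%:C != 0.
  by rewrite brf mulf_neq0 // (inj_eq (@complexI R) _ 0).
have [bf0 N0] : bracket (g (f12 - f)) (g (f2 - f1)) != 0 /\
    (rho N 0 2%:R)%:C != 0 :> C.
  by move: brfN0; rewrite mulf_eq0 negb_or => /andP[].
have [||||e13 e24 par nall] := @concyclic_parallel_gauss_map R k1 k2 k3 k4
  (r ^+ 2)%:C
  (g (f - c)) (g (f1 - c)) (g (f12 - c)) (g (f2 - c)) rho0 _ uniqg.
- by split; apply: gN.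
- rewrite !gE -!gZ -!gD -h1 -h2 -h3 -h4.
  by rewrite !subr_telescope subrr /g (rotation0 uX rhoP) /planar_coord !mxE.
- rewrite !gE -!gZ -!gD -nE -nE'.
  rewrite !subr_telescope.
  apply: (mulIf N0); rewrite mulNr brf brn detK rmorphN; ring.
- rewrite !gE -!gD.
  rewrite !subr_telescope.
  exact: bf0.
split=> //; apply: (@complexI R).
  by move: e13; rewrite !gE !ge // !(rmorphM, rmorphD, rmorph1, rmorphXn).
by move: e24; rewrite !gE !ge // !(rmorphM, rmorphD, rmorph1, rmorphXn).
Qed.
End Quadrilateral.

(** * Lax data of the quadrilateral *)

Section Assembly.
Variable R : realType.
Local Notation C := R[i].
Local Notation M2 := 'M[R[i]]_2.
Implicit Types (x y f n u : 'rV[R]_3).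

Lemma vertex_ratioM (k1 k2 k3 k4 : R) :
  (1 - k1 * k3) * (k2 + k4) = (1 - k2 * k4) * (k1 + k3) ->
  vertex_ratio k1 * vertex_ratio k3 = vertex_ratio k4 * vertex_ratio k2.
Proof.
move=> /(congr1 (real_complex R)).
rewrite !(rmorphM, rmorphB, rmorphD, rmorph1) => h.
rewrite /vertex_ratio !mulf_div; apply/eqP.
rewrite eqr_div ?mulf_neq0 ?oneDik_neq0 //; apply/eqP.
apply: (lincomb2 (2 * 'i%C) (2 * 'i%C * (k1%:C * k3%:C * (k2%:C + k4%:C)
    - k2%:C * k4%:C * (k1%:C + k3%:C))) h (mul_ii R)).
ring.
Qed.

Lemma unit_vertex_ratio (k : R) : vertex_ratio k * (vertex_ratio k)^J = 1.
Proof. by rewrite vertex_ratioJ mulfV ?vertex_ratio_neq0. Qed.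

(** The polynomial with the excluded numbers as roots has finitely many roots, but
there are infinitely many unit numbers [(1 - i j) / (1 + i j)]. *)
Lemma exists_unit_avoiding (cs : seq C) :
  exists s : C, s * s^J = 1 /\ forall c : C, c \in cs -> s ^+ 2 != c.
Proof.
pose p : {poly C} := \prod_(c <- cs) ('X^2 - c%:P).
have p0 : p != 0.
  rewrite /p prodf_seq_neq0; apply/allP => c _ /=.
  by rewrite -size_poly_gt0 size_XnsubC.
pose rs := [seq vertex_ratio (j%:R : R) | j <- iota 0 (size p)].
have rs_uniq : uniq rs.
  rewrite map_inj_uniq ?iota_uniq // => i j /vertex_ratio_inj/eqP.
  by rewrite eqr_nat => /eqP.
have : ~~ all (root p) rs.
  apply/negP => h; have := max_poly_roots p0 h rs_uniq.
  by rewrite size_map size_iota ltnn.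
move=> /allPn[s /mapP[j _ ->] nroot]; exists (vertex_ratio j%:R).
split; first exact: unit_vertex_ratio.
move=> c c_in; apply: contra nroot => /eqP sc.
rewrite /p (big_rem c c_in) /= rootM; apply/orP; left.
by rewrite /root !hornerE sc subrr.
Qed.

Lemma exists_lax_parameter (S : R) : 0 < S ->
  exists delta r, [/\ lax_parameter delta, ctan (delta / 2) != 0,
    ctan (delta / 2) + (ctan (delta / 2))^-1 = r%:C :> C &
    r%:C ^+ 2 = 16 / S%:C].
Proof.
move=> S0; pose q := Num.sqrt S / 2.
have q0 : 0 < q by rewrite divr_gt0 ?sqrtr_gt0.
have q2 : q ^+ 2 * 4 = S by rewrite /q expr_div_n sqr_sqrtr ?ltW //; field.
move: q q0 q2 => q q0 q2; have [delta sE dP] := exists_csin q0.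
have qC0 : q%:C != 0 :> C by rewrite (inj_eq (@complexI R) _ 0) gt_eqF.
have [|s0 c0 T0 TE] := @ctan_half R delta; first by rewrite sE.
exists delta, (2 / q); split=> //.
  by rewrite TE sE rmorphM fmorphV rmorph_nat.
have -> : S%:C = q%:C ^+ 2 * 4 :> C by rewrite -q2 rmorphM rmorphXn rmorph_nat.
rewrite rmorphM fmorphV rmorph_nat; field.
by [].
Qed.

Lemma lax_quat1 (a w : C) : lax_quat a w 1 = quat a ('i%C * (1 - w)).
Proof. by rewrite /lax_quat divr1. Qed.

Lemma frame_at_edge_vertices X X' f n f' n' (k : R) :
    frame_at X X' f n -> f' != f -> edge_constraint_edge f n f' n' ->
    n + n' != 0 -> n' - n = k *: (f' - f) ->
  let w := vertex_ratio k in
  exists a, [/\ a != 0,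
    a * a^J = 16 / ((1 + k ^+ 2) * dot (f' - f) (f' - f))%:C - (2 - w - w^J) &
    frame_at (lax_quat a w 1 *m X)
      (quat 0 ('i%C * (1 + w)) *m X + lax_quat a w 1 *m X') f' n'].
Proof.
move=> FX ff he hs hk w.
have n'E : n' = n + k *: (f' - f) by rewrite -hk addrC subrK.
have e0 : f' - f != 0 by rewrite subr_eq0.
have [||a] := frame_at_edge (k := k) FX e0; rewrite -?n'E //.
rewrite [f + _]addrC subrK => -[a0 aa Fa].
by exists a; rewrite lax_quat1.
Qed.

Lemma lax_quat_unit (a w : C) (la : C) : a != 0 -> lax_quat a w la \in unitmx.
Proof. by move=> a0; exact: quat_lax_unit. Qed.

Lemma quaternion_lax_quat (a w : C) (la : C) : quaternion (lax_quat a w la).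
Proof. by apply/quaternionP; eexists; eexists. Qed.

Lemma nonzero_quaternion_valuedP (Phi : R -> M2) :
  (forall l, 0 < l -> quaternion (Phi l) /\ Phi l \in unitmx) ->
  nonzero_quaternion_valued Phi.
Proof.
move=> h l l0; have [q u] := h l l0; split=> //.
by apply: contraTneq u => ->; rewrite unitmxE det0 unitr0.
Qed.

Lemma edge_parameter_gt0 (f f' : 'rV[R]_3) (k : R) : f' != f ->
  0 < (1 + k ^+ 2) * dot (f' - f) (f' - f).
Proof.
move=> ff; apply: mulr_gt0; first by rewrite ltr_wpDr ?sqr_ge0.
have h : 0 <= dot (f' - f) (f' - f) by rewrite dotE !addr_ge0 // -expr2 sqr_ge0.
by rewrite lt0r h dot_eq0 subr_eq0 ff.
Qed.

(** The two ways around the quadrilateral lead to frames of the same point and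
normal. The derivative does not vanish because the first and the last vertex
are distinct. *)
Lemma frames_close_lax (X X' : M2) f n f12 n12 (a c c1 a2 w v v1 w2 : C) :
    frame_at X X' f n ->
    frame_at (lax_quat c1 v1 1 *m (lax_quat a w 1 *m X))
      (quat 0 ('i%C * (1 + v1)) *m (lax_quat a w 1 *m X) + lax_quat c1 v1 1 *m
       (quat 0 ('i%C * (1 + w)) *m X + lax_quat a w 1 *m X')) f12 n12 ->
    frame_at (lax_quat a2 w2 1 *m (lax_quat c v 1 *m X))
      (quat 0 ('i%C * (1 + w2)) *m (lax_quat c v 1 *m X) + lax_quat a2 w2 1 *m
       (quat 0 ('i%C * (1 + v)) *m X + lax_quat c v 1 *m X')) f12 n12 ->
    f != f12 -> [/\ w^J = w^-1, v^J = v^-1, w != 0 & v != 0] ->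
    w * w2 = v * v1 -> ~ [/\ w = v, v1 = w & w2 = v] ->
  forall la : C, la^J = la -> la != 0 ->
    lax_quat c1 v1 la *m lax_quat a w la = lax_quat a2 w2 la *m lax_quat c v la.
Proof.
move=> [_ uX _ Xf] FML FLM ff unitwv wv nwv.
have [z [zE zE']] := frame_at_unique FML FLM.
have [_ uY _ Yf] := FML.
move: (lax_quat a w 1) (lax_quat c v 1) (lax_quat c1 v1 1) (lax_quat a2 w2 1)
  (quat 0 ('i%C * (1 + w))) (quat 0 ('i%C * (1 + v)))
  (quat 0 ('i%C * (1 + v1))) (quat 0 ('i%C * (1 + w2)))
  (@lax_compatible_at1 R a c c1 a2 w v v1 w2 z) zE zE' uY Yf.
move=> L M M1 L2 L' M' M1' L2' compat zE zE' uY Yf la laR la0.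
have closed1 : M1 *m L = quat z 0 *m (L2 *m M).
  by apply: (can_inj (mulmxK uX)); rewrite -!mulmxA zE.
have dE : M1' *m (L *m X) + M1 *m (L' *m X + L *m X') =
    (M1' *m L + M1 *m L') *m X + M1 *m L *m X'.
  by rewrite mulmxDl mulmxDr !mulmxA addrA.
apply: (compat la unitwv wv nwv closed1) laR la0.
  apply: (can_inj (mulmxK uX)); apply: (addIr (M1 *m L *m X')).
  by rewrite -dE zE' closed1 !(mulmxDr, mulmxDl) !mulmxA addrA.
apply: contraNneq ff => D0; apply/eqP; apply: imquat_inj.
apply: (can_inj (mulKmx uY)).
by move: Yf; rewrite dE D0 mul0mx add0r scalemxAr Xf !mulmxA.
Qed.

(** Any unit [s] extends to the other three vertices, the fourth product being
matched by [w w2 = v v1]. The sums [s + s'] vanish on an edge only for one value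
of [s^2]. *)
Lemma exists_vertex_variables (w v v1 w2 : C) :
    [/\ w * w^J = 1, v * v^J = 1 & v1 * v1^J = 1] -> w * w2 = v * v1 ->
  exists s s1 s2 s12 : C,
    [/\ [/\ s * s^J = 1, s1 * s1^J = 1, s2 * s2^J = 1 & s12 * s12^J = 1],
        [/\ s * s1 = w, s * s2 = v, s1 * s12 = v1 & s2 * s12 = w2] &
        [/\ s + s1 != 0, s + s2 != 0, s1 + s12 != 0 & s2 + s12 != 0]].
Proof.
move=> [uw uv uv1] wv.
have unit0 (x : C) : x * x^J = 1 -> x != 0.
  by apply: contra_eq_neq => ->; rewrite mul0r eq_sym oner_eq0.
have w0 := unit0 _ uw; have v0 := unit0 _ uv; have v10 := unit0 _ uv1.
pose cs := [:: - w; - v; - (w ^+ 2 / v1); - (v * w / v1)].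
have [s [us s_avoid]] := exists_unit_avoiding cs; have s0 := unit0 _ us.
have unitM (x y : C) : x * x^J = 1 -> y * y^J = 1 -> (x * y) * (x * y)^J = 1.
  by move=> x1 y1; rewrite conjcM mulrACA x1 y1 mulr1.
have unitV (x : C) : x * x^J = 1 -> x^-1 * (x^-1)^J = 1.
  by move=> x1; rewrite conjcV -invfM x1 invr1.
have avoid (x t t' : C) : x \in cs -> t != 0 -> t' * t = s ^+ 2 - x -> t' != 0.
  move=> x_in t0 tt; apply: contraNneq (s_avoid x x_in) => t'0.
  by move: tt; rewrite t'0 mul0r => /esym/eqP; rewrite subr_eq0.
have t0 : w * s / v1 != 0 by rewrite !mulf_neq0 ?invr_eq0.
exists s, (w / s), (v / s), (v1 * s / w); split; split.
- exact: us.
- exact: unitM uw (unitV _ us).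
- exact: unitM uv (unitV _ us).
- exact: unitM (unitM _ _ uv1 us) (unitV _ uw).
- by rewrite mulrC divfK.
- by rewrite mulrC divfK.
- by field; rewrite w0 s0.
- by apply: (mulIf w0); rewrite [RHS]mulrC wv; field; rewrite w0 s0.
- by apply: (avoid (- w) s); rewrite ?inE ?eqxx ?orbT //; field.
- by apply: (avoid (- v) s); rewrite ?inE ?eqxx ?orbT //; field.
- apply: (avoid (- (w ^+ 2 / v1)) _ _ _ t0); rewrite ?inE ?eqxx ?orbT //.
  by field; rewrite v10 w0 s0.
- apply: (avoid (- (v * w / v1)) _ _ _ t0); rewrite ?inE ?eqxx ?orbT //.
  by field; rewrite v10 w0 s0.
Qed.

Lemma lax_solution_through_frame (D : lax_data R) (X : M2)
    (f n f1 n1 f2 n2 f12 n12 : 'rV[R]_3) (a c c1 a2 w v v1 w2 : C) :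
    let X' := X *m (2^-1 *: imquat f) in
    let X1 := lax_quat a w 1 *m X in
    let X1' := quat 0 ('i%C * (1 + w)) *m X + lax_quat a w 1 *m X' in
    let X2 := lax_quat c v 1 *m X in
    let X2' := quat 0 ('i%C * (1 + v)) *m X + lax_quat c v 1 *m X' in
    let X12 := lax_quat c1 v1 1 *m X1 in
    let X12' := quat 0 ('i%C * (1 + v1)) *m X1 + lax_quat c1 v1 1 *m X1' in
    [/\ a != 0, c != 0 & c1 != 0] ->
    [/\ frame_at X X' f n, frame_at X1 X1' f1 n1, frame_at X2 X2' f2 n2 &
        frame_at X12 X12' f12 n12] ->
    (forall lam : R, 0 < lam ->
      [/\ lax_L D lam = lax_quat a w lam%:C, lax_M D lam = lax_quat c v lam%:C,
          lax_M1 D lam = lax_quat c1 v1 lam%:C &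
          lax_L2 D lam = lax_quat a2 w2 lam%:C]) ->
    lax_compatible D ->
  exists Phi Phi1 Phi2 Phi12 : R -> M2,
    [/\ lax_solution D Phi Phi1 Phi2 Phi12,
        [/\ nonzero_quaternion_valued Phi, nonzero_quaternion_valued Phi1,
            nonzero_quaternion_valued Phi2 & nonzero_quaternion_valued Phi12],
        [/\ smooth_frame Phi, smooth_frame Phi1, smooth_frame Phi2
          & smooth_frame Phi12]
      & [/\ frame_represents Phi f n, frame_represents Phi1 f1 n1,
            frame_represents Phi2 f2 n2 & frame_represents Phi12 f12 n12]].
Proof.
move=> X' X1 X1' X2 X2' X12 X12' [a0 c0 c10] [FX F1 F2 F12] lax compat.
pose Phi := base_frame X f.
pose Phi1 lam := lax_quat a w lam%:C *m Phi lam.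
pose Phi2 lam := lax_quat c v lam%:C *m Phi lam.
pose Phi12 lam := lax_quat c1 v1 lam%:C *m Phi1 lam.
have PF := laurent_base_frame X f.
have PF1 := laurent_frameM (laurent_frame_lax a w) PF.
have PF2 := laurent_frameM (laurent_frame_lax c v) PF.
have PF12 := laurent_frameM (laurent_frame_lax c1 v1) PF1.
have [qX uX _ _] := FX.
have nzPhi lam : quaternion (Phi lam) /\ Phi lam \in unitmx.
  have [q1 q2] := imquat_addr1_unit ((lam - 1) / 2) f.
  by split; [exact: quaternionM|rewrite unitmx_mul uX].
have nzM b b' (P : M2) lam : b != 0 -> quaternion P /\ P \in unitmx ->
    quaternion (lax_quat b b' lam *m P) /\ lax_quat b b' lam *m P \in unitmx.
  move=> b0 [qP uP]; split; first exact: quaternionM (quaternion_lax_quat _ _ _) qP.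
  by rewrite unitmx_mul lax_quat_unit.
have nzPhi1 lam := nzM a w (Phi lam) lam%:C a0 (nzPhi lam).
have nzPhi2 lam := nzM c v (Phi lam) lam%:C c0 (nzPhi lam).
have nzPhi12 lam := nzM c1 v1 (Phi1 lam) lam%:C c10 (nzPhi1 lam).
exists Phi, Phi1, Phi2, Phi12; split.
- move=> lam lam0; have [LE ME M1E L2E] := lax lam lam0.
  split; [by rewrite LE|by rewrite ME|by rewrite M1E|].
  rewrite /Phi12 /Phi1 /Phi2 !mulmxA -M1E -LE -ME.
  by rewrite (compat lam lam0).
- by split; apply: nonzero_quaternion_valuedP => lam _;
    [exact: nzPhi|exact: nzPhi1|exact: nzPhi2|exact: nzPhi12].
- by split; [exact: laurent_frame_smooth PF|exact: laurent_frame_smooth PF1|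
    exact: laurent_frame_smooth PF2|exact: laurent_frame_smooth PF12].
have P1 : Phi 1 = X := base_frame1 X f.
split.
- exact: frame_represents_at PF P1 erefl FX.
- by apply: (frame_represents_at PF1 _ _ F1); rewrite /Phi1 /Phi base_frame1.
- by apply: (frame_represents_at PF2 _ _ F2); rewrite /Phi2 /Phi base_frame1.
- by apply: (frame_represents_at PF12 _ _ F12); rewrite /Phi12 /Phi1 /Phi base_frame1.
Qed.
End Assembly.

Theorem theorem2p6 (R : realType)
    (f f1 f12 f2 n n1 n12 n2 N : 'rV[R]_3)
    (hcirc : circular_quad f f1 f12 f2)
    (hunit : [/\ unit_vector n, unit_vector n1, unit_vector n12
               & unit_vector n2])
    (hedge : edge_constraint_quad f f1 f12 f2 n n1 n12 n2)
    (* no edge has antipodal normals at its endpoints *)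
    (hsum : [/\ n + n1 != 0, n1 + n12 != 0, n12 + n2 != 0 & n2 + n != 0])
    (hpar : parallel_gauss_map f f1 f12 f2 n n1 n12 n2)
    (hN : face_normal n n1 n12 n2 N)
    (hK : gauss_curvature f f1 f12 f2 n n1 n12 n2 N = -1) :
  exists D : lax_data R,
    [/\ lax_data_ok D, lax_compatible D &
      exists Phi Phi1 Phi2 Phi12 : R -> 'M[R[i]]_2,
        [/\ lax_solution D Phi Phi1 Phi2 Phi12,
            [/\ nonzero_quaternion_valued Phi, nonzero_quaternion_valued Phi1,
                nonzero_quaternion_valued Phi2
              & nonzero_quaternion_valued Phi12],
            [/\ smooth_frame Phi, smooth_frame Phi1, smooth_frame Phi2
              & smooth_frame Phi12]
          & [/\ frame_represents Phi f n, frame_represents Phi1 f1 n1,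
                frame_represents Phi2 f2 n2
              & frame_represents Phi12 f12 n12]]].
Proof.
have [u0 _ _ _] := hunit; have [s01 s112 s122 s20] := hsum.
have [c01 c112 c122 c20] := hedge.
have [[k1 h1] [k2 h2] [k3 h3] [k4 h4]] := hpar.
have [] := circular_quad_closing hcirc (And4 h1 h2 h3 h4) hK.
have [uniqf _] := hcirc; move: uniqf; rewrite /= !inE !negb_or !andbT.
move=> /and3P[/and3P[f01 f012 f02] /andP[f112 _] f122] len1 len2 par nall.
pose w := vertex_ratio k1; pose v := vertex_ratio k4.
pose v1 := vertex_ratio k2; pose w2 := vertex_ratio k3.
have wv : w * w2 = v * v1 by exact: vertex_ratioM.
have w0 : w != 0 := vertex_ratio_neq0 k1; have v0 : v != 0 := vertex_ratio_neq0 k4.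
have [X [qX uX Xn]] := exists_frame u0.
pose X' := X *m (2^-1 *: imquat f).
have two0 : 2 != 0 :> R[i] by rewrite pnatr_eq0.
have FX : frame_at X X' f n.
  by split=> //; rewrite /X' scalemxAr scalerA mulfV ?scale1r.
have edgeC (g m g' m' : 'rV[R]_3) : edge_constraint_edge g m g' m' ->
    edge_constraint_edge g' m' g m.
  rewrite /edge_constraint_edge !dotE !mxE => h.
  by apply: (lincomb1 (-1) h); ring.
have revk (g m g' m' : 'rV[R]_3) k :
    m - m' = k *: (g - g') -> m' - m = k *: (g' - g).
  by move=> h; rewrite -opprB h -scalerN opprB.
have ne1 : f1 != f by rewrite eq_sym.
have ne2 : f2 != f by rewrite eq_sym.
have ne12 : f12 != f1 by rewrite eq_sym.
have s02 : n + n2 != 0 by rewrite addrC.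
have s212 : n2 + n12 != 0 by rewrite addrC.
have c02 := edgeC _ _ _ _ c20; have c212 := edgeC _ _ _ _ c122.
have h4' := revk _ _ _ _ _ h4; have h3' := revk _ _ _ _ _ h3.
have [a [a0 aa FL]] := frame_at_edge_vertices FX ne1 c01 s01 h1.
have [c [c0 cc FM]] := frame_at_edge_vertices FX ne2 c02 s02 h4'.
have [c1 [c10 c1c1 FML]] := frame_at_edge_vertices FL ne12 c112 s112 h2.
have [a2 [a20 a2a2 FLM]] := frame_at_edge_vertices FM f122 c212 s212 h3'.
rewrite -/w -/v -/v1 -/w2 in aa FL cc FM c1c1 FML a2a2 FLM.
have uw := unit_vertex_ratio k1; have uv := unit_vertex_ratio k4.
have uv1 := unit_vertex_ratio k2.
have compat : forall la : R[i], la^J = la -> la != 0 ->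
    lax_quat c1 v1 la *m lax_quat a w la = lax_quat a2 w2 la *m lax_quat c v la.
  apply: (frames_close_lax FX FML FLM f012 _ wv).
    by split; rewrite ?vertex_ratioJ.
  move=> [e1 e2 e3]; apply: nall; split.
  - by rewrite (vertex_ratio_inj e2).
  - by rewrite (vertex_ratio_inj e2) (vertex_ratio_inj e1) (vertex_ratio_inj e3).
  - exact: vertex_ratio_inj e3.
have [s [s1 [s2 [s12 [[us us1 us2 us12] [ss1 ss2 s1s12 s2s12]
  [n01 n02 n112 n212]]]]]] := exists_vertex_variables (And3 uw uv uv1) wv.
have dotC (g g' : 'rV[R]_3) : dot (g - g') (g - g') = dot (g' - g) (g' - g).
  by rewrite !dotE !mxE; ring.
have [d1 [r1 [d1P T1 Tr1 r1E]]] := exists_lax_parameter (edge_parameter_gt0 k1 ne1).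
have [d2 [r2 [d2P T2 Tr2 r2E]]] := exists_lax_parameter (edge_parameter_gt0 k4 ne2).
have [|l [lE lL]] := exists_lax_edge (a := a) erefl T1 Tr1 us us1 n01 a0.
  by rewrite ss1 r1E.
have [|m [mE mM]] := exists_lax_edge (a := c) erefl T2 Tr2 us us2 n02 c0.
  by rewrite ss2 r2E.
have [|l2 [l2E lL2]] := exists_lax_edge (a := a2) erefl T1 Tr1 us2 us12 n212 a20.
  by rewrite s2s12 r1E len1 dotC.
have [|m1 [m1E mM1]] := exists_lax_edge (a := c1) erefl T2 Tr2 us1 us12 n112 c10.
  by rewrite s1s12 r2E [dot (f2 - f) _]dotC -len2.
rewrite ss1 in lL; rewrite ss2 in mM; rewrite s2s12 in lL2; rewrite s1s12 in mM1.
have laxE (lam : R) : 0 < lam -> let D := LaxData s s1 s2 s12 l l2 m m1 d1 d2 in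
    [/\ lax_L D lam = lax_quat a w lam%:C, lax_M D lam = lax_quat c v lam%:C,
        lax_M1 D lam = lax_quat c1 v1 lam%:C &
        lax_L2 D lam = lax_quat a2 w2 lam%:C].
  by move=> lam0 D; split; [exact: lL|exact: mM|exact: mM1|exact: lL2].
have ok : lax_data_ok (LaxData s s1 s2 s12 l l2 m m1 d1 d2).
  by split; [split; exact/unit_normP|exact: d1P|exact: d2P|split].
(* only the values of the Lax matrices matter from here on *)
move: (LaxData _ _ _ _ _ _ _ _ _ _) laxE ok => D laxE ok.
have Dcompat : lax_compatible D.
  move=> lam lam0; have [-> -> -> ->] := laxE lam lam0.
  apply: compat; first exact: conjc_real.
  by rewrite (inj_eq (@complexI R) _ 0) gt_eqF.
exists D; split=> //.
exact: lax_solution_through_frame (And3 a0 c0 c10) (And4 FX FL FM FML) laxE Dcompat.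
Qed.
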